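(* Let $f:\mathbb{R}^n\to\mathbb{R}\cup\{+\infty\}$ be proper, convex and lower semicontinuous, and let $g:\mathbb{R}^n\to\mathbb{R}$ be a (possibly nonconvex) Fréchet differentiable function whose gradient is $\beta$-Lipschitz continuous for some $\beta\ge 0$. Suppose that $f+g$ is bounded from below and that $\eta>0$ satisfies $\eta\beta(3+\eta\beta)<1$. For $x_0\in\mathbb{R}^n$, let $x\in C^1([0,+\infty),\mathbb{R}^n)$ be the unique global solution of $$\dot x(t)+x(t)=\operatorname{prox}_{\eta f}\big(x(t)-\eta\nabla g(x(t))\big),\qquad x(0)=x_0,$$ and consider the function $$H:\mathbb{R}^n\times\mathbb{R}^n\to\mathbb{R}\cup\{+\infty\},\qquad H(u,v)=(f+g)(u)+\frac{1}{2\eta}\|u-v\|^2.$$ Suppose that $x$ is bounded and that $H$ satisfies the KL property at each point of $\operatorname{dom}\partial H$ with a function $\varphi$ of the form $\varphi(s)=Cs^{1-\theta}$, where $C>0$ and $\theta\in(0,1)$ (which may depend on the point). Then there exists $\overline x\in\operatorname{crit}(f+g)$ such that $\lim_{t\to+\infty}x(t)=\overline x$. Moreover, let $\theta\in(0,1)$ be the Łojasiewicz exponent of $H$ at $(\overline x,\overline x)\in\operatorname{crit}H$, i.e. $\theta$ is such that for some $C,\varepsilon>0$, $$|H(u,v)-H(\overline x,\overline x)|^{\theta}\le C\|w\|\quad\text{for every }(u,v)\text{ with }\|(u,v)-(\overline x,\overline x)\|<\varepsilon\text{ and every }w\in\partial H(u,v).$$ Then there exist $a,b,c,d>0$ and $t_0\ge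 0$ such that for every $t\ge t_0$ the following hold: (a) if $\theta\in(0,\frac12)$, then $x$ converges in finite time (i.e. there is $T\ge 0$ such that $x$ is constant, equal to $\overline x$, on $[T,+\infty)$); (b) if $\theta=\frac12$, then $\|x(t)-\overline x\|\le a\exp(-bt)$; (c) if $\theta\in(\frac12,1)$, then $\|x(t)-\overline x\|\le (ct+d)^{-\left(\frac{1-\theta}{2\theta-1}\right)}$.
   Context: $\mathbb{R}^n$ carries the Euclidean inner product and norm. The proximal point operator is $\operatorname{prox}_{\eta f}(y)=\operatorname{argmin}_{u\in\mathbb{R}^n}\{f(u)+\frac{1}{2\eta}\|u-y\|^2\}$; it is nonexpansive, and the dynamical system has a unique global $C^1$ solution by the Cauchy–Lipschitz theorem. For a proper lower semicontinuous $h:\mathbb{R}^m\to\mathbb{R}\cup\{+\infty\}$ with $\operatorname{dom}h=\{x:h(x)<+\infty\}$, the Fréchet subdifferential at $x\in\operatorname{dom}h$ is $\hat\partial h(x)=\{v:\liminf_{y\to x}\frac{h(y)-h(x)-\langle v,y-x\rangle}{\|y-x\|}\ge 0\}$, and the limiting (Mordukhovich) subdifferential is $\partial h(x)=\{v:\exists x_k\to x,\ h(x_k)\to h(x),\ \exists v_k\in\hat\partial h(x_k),\ v_k\to v\}$; both are empty for $x\notin\operatorname{dom}h$. $\operatorname{crit}(h)=\{x:0\in\partial h(x)\}$, $\operatorname{dom}\partial h=\{x:\partial h(x)\ne\emptyset\}$, and $\operatorname{dist}(x,A)=\inf_{y\in A}\|x-y\|$. For $\mu\in(0,+\infty]$,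 $\Theta_\mu$ is the class of concave continuous functions $\varphi:[0,\mu)\to[0,+\infty)$ with $\varphi(0)=0$, $\varphi$ continuously differentiable on $(0,\mu)$ and $\varphi'(s)>0$ for all $s\in(0,\mu)$. A proper lower semicontinuous $h$ satisfies the Kurdyka–Łojasiewicz (KL) property at $\overline x\in\operatorname{dom}\partial h$ (with the function $\varphi$) if there exist $\mu\in(0,+\infty]$, a neighborhood $U$ of $\overline x$ and $\varphi\in\Theta_\mu$ such that $\varphi'(h(x)-h(\overline x))\operatorname{dist}(0,\partial h(x))\ge 1$ for all $x\in U$ with $h(\overline x)<h(x)<h(\overline x)+\mu$. *)

(* Defs.v *)
(* R^m is 'rV[R]_m.  The norm `|x| that the library puts on row vectors is the
   sup norm, so the Euclidean norm is defined here as [enorm]; it is the one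
   used in every quantitative statement.  Limits, neighbourhoods, continuity,
   lower semicontinuity and Frechet differentiability are the library's
   notions for 'rV[R]_m: these depend only on the topology (resp. on the norm
   up to equivalence), which is the Euclidean one. *)
From mathcomp Require Export all_boot all_order all_algebra.
From mathcomp Require Export all_classical all_reals all_analysis.

Set Implicit Arguments.
Unset Strict Implicit.
Unset Printing Implicit Defensive.

Export Order.TTheory GRing.Theory Num.Theory.
Export numFieldNormedType.Exports.

Local Open Scope classical_set_scope.
Local Open Scope ring_scope.

Definition dotv (R : realType) (m : nat) (u v : 'rV[R]_m) : R :=
  \sum_(i < m) u 0 i * v 0 i.

Definition enorm (R : realType) (m : nat) (u : 'rV[R]_m) : R :=
  Num.sqrt (dotv u u).

(* [grad g u] is meaningful when [g] is differentiable at [u]. *)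
Definition grad (R : realType) (m : nat) (g : 'rV[R]_m -> R) (u : 'rV[R]_m) :
    'rV[R]_m :=
  \row_(i < m) 'd g u (delta_mx 0 i).

(* Functions R^m -> R u {+oo} are functions to \bar R which, being proper,
   never take the value -oo. *)
Definition dom (R : realType) (m : nat) (h : 'rV[R]_m -> \bar R) :
    set 'rV[R]_m :=
  [set x | (h x < +oo)%E].

Definition proper_fun (R : realType) (m : nat) (h : 'rV[R]_m -> \bar R) : Prop :=
  (forall x, h x != -oo%E) /\ (exists x, dom h x).

(* The library's [convex_function] is restricted to real-valued functions.
   In \bar R, 0 * +oo = 0, so the cases t = 0 and t = 1 are trivial. *)
Definition convex_efun (R : realType) (m : nat) (h : 'rV[R]_m -> \bar R) : Prop :=
  forall (x y : 'rV[R]_m) (t : R), 0 <= t <= 1 ->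
    (h (t *: x + (1 - t) *: y)%R <= t%:E * h x + (1 - t)%:E * h y)%E.

Definition argmin (R : realType) (m : nat) (h : 'rV[R]_m -> \bar R) :
    set 'rV[R]_m :=
  [set u | forall w, (h u <= h w)%E].

(* [get] selects the element of the argmin, which is a singleton when [f] is
   proper, convex and lower semicontinuous and [0 < eta]. *)
Definition prox (R : realType) (m : nat) (eta : R) (f : 'rV[R]_m -> \bar R)
    (y : 'rV[R]_m) : 'rV[R]_m :=
  get (argmin (fun u => f u + (1 / (2 * eta) * enorm (u - y) ^+ 2)%:E)%E).

(* [dx] is the derivative of [x] on [0, +oo[, one-sided at 0; the values of
   [x] and [dx] at negative times play no role. *)
Definition derivative_on_halfline (R : realType) (m : nat)
    (x dx : R -> 'rV[R]_m) : Prop :=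
  forall t, 0 <= t ->
    (s - t)^-1 *: (x s - x t) @[s --> within [set r | 0 <= r] t^'] --> dx t.

(* [x] is a C^1 solution on [0, +oo[ of the forward-backward system
   x' + x = prox_{eta f} (x - eta grad g(x)),  x(0) = x0. *)
Definition FB_solution (R : realType) (n : nat) (eta : R)
    (f : 'rV[R]_n -> \bar R) (g : 'rV[R]_n -> R) (x0 : 'rV[R]_n)
    (x : R -> 'rV[R]_n) : Prop :=
  exists dx : R -> 'rV[R]_n,
    [/\ derivative_on_halfline x dx,
        {within [set r : R | 0 <= r], continuous dx},
        x 0 = x0 &
        forall t, 0 <= t ->
          dx t + x t = prox eta f (x t - eta *: grad g (x t))].

Definition frechet_subdiff (R : realType) (m : nat) (h : 'rV[R]_m -> \bar R)
    (x : 'rV[R]_m) : set 'rV[R]_m :=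
  [set v | dom h x /\
    (0 <= limf_einf
            (fun y => (h y - h x - (dotv v (y - x))%:E)
                        * ((enorm (y - x))^-1)%:E) x^')%E].

Definition limiting_subdiff (R : realType) (m : nat) (h : 'rV[R]_m -> \bar R)
    (x : 'rV[R]_m) : set 'rV[R]_m :=
  [set v | dom h x /\
    exists (xk vk : nat -> 'rV[R]_m),
      [/\ xk @ \oo --> x,
          (h \o xk) @ \oo --> h x,
          forall k, frechet_subdiff h (xk k) (vk k) &
          vk @ \oo --> v]].

Definition crit (R : realType) (m : nat) (h : 'rV[R]_m -> \bar R) :
    set 'rV[R]_m :=
  [set x | limiting_subdiff h x 0].

Definition dom_subdiff (R : realType) (m : nat) (h : 'rV[R]_m -> \bar R) :
    set 'rV[R]_m :=
  [set x | limiting_subdiff h x !=set0].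

(* Extended-real valued, so that the distance to the empty set is +oo. *)
Definition edist (R : realType) (m : nat) (x : 'rV[R]_m) (A : set 'rV[R]_m) :
    \bar R :=
  ereal_inf [set (enorm (x - y))%:E | y in A].

(* The class Theta_mu; only the restriction of [phi] to [0, mu[ matters. *)
Definition Theta (R : realType) (mu : \bar R) (phi : R -> R) : Prop :=
  let I := [set s : R | 0 <= s /\ (s%:E < mu)%E] in
  let I' := [set s : R | 0 < s /\ (s%:E < mu)%E] in
  [/\ (forall s, I s -> 0 <= phi s) /\ phi 0 = 0,
      forall s r t, I s -> I r -> 0 <= t <= 1 ->
        t * phi s + (1 - t) * phi r <= phi (t * s + (1 - t) * r),
      {within I, continuous phi},
      (forall s, I' s -> derivable phi s 1) /\
        {within I', continuous (derive1 phi)} &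
      forall s, I' s -> 0 < derive1 phi s].

Definition KL_property (R : realType) (m : nat) (h : 'rV[R]_m -> \bar R)
    (xbar : 'rV[R]_m) (phi : R -> R) : Prop :=
  exists (mu : \bar R) (U : set 'rV[R]_m),
    [/\ (0 < mu)%E, nbhs xbar U, Theta mu phi &
        forall x, U x -> (h xbar < h x)%E -> (h x < h xbar + mu)%E ->
          (1 <= (derive1 phi (fine (h x - h xbar)%E))%:E
                  * edist 0 (limiting_subdiff h x))%E].

Definition lojasiewicz_exponent (R : realType) (m : nat)
    (h : 'rV[R]_m -> \bar R) (xbar : 'rV[R]_m) (theta : R) : Prop :=
  exists C eps : R,
    [/\ 0 < C, 0 < eps &
        forall x w, enorm (x - xbar) < eps -> limiting_subdiff h x w ->
          (`|h x - h xbar| `^ theta <= (C * enorm w)%:E)%E].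

Definition objective (R : realType) (n : nat) (f : 'rV[R]_n -> \bar R)
    (g : 'rV[R]_n -> R) (u : 'rV[R]_n) : \bar R :=
  (f u + (g u)%:E)%E.

(* R^n x R^n is 'rV[R]_(n + n), the pair (u, v) being [row_mx u v]: its
   inner product and norm are then those of the product. *)
Definition Hfun (R : realType) (n : nat) (eta : R) (f : 'rV[R]_n -> \bar R)
    (g : 'rV[R]_n -> R) (z : 'rV[R]_(n + n)) : \bar R :=
  let u := lsubmx z in let v := rsubmx z in
  (objective f g u + (1 / (2 * eta) * enorm (u - v) ^+ 2)%:E)%E.

(* Main.v *)
(* Write p = x + x' for the proximal point, so that -x'/eta - grad g(x) is a
   subgradient of f at p.  Convexity of f, the quadratic bound on g and the
   nonexpansiveness of the resolvent give, for any two times s and t,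
     H(p(s),x(s)) - H(p(t),x(t)) <= - <x'(s),x(s)-x(t)> / eta
         + beta (1 + eta beta) |x'(s)| |x(s)-x(t)| + O(|x(s)-x(t)|^2),
   so the upper right Dini derivative of t |-> H(p(t),x(t)) is at most
   - c |x'(t)|^2 with c > 0.  All differential inequalities are handled with
   Dini derivatives, so neither second derivatives of x nor integrals occur.
   Hence x' -> 0, a cluster point xbar is critical, and the energy gap
   r = H(p,x) - H(xbar,xbar) tends to 0.  As H has a subgradient of size
   O(|x'|) at (p,x), the KL property reads r^theta <= K |x'| near xbar, which
   makes r^(1-theta) plus a multiple of the distance travelled nonincreasing:
   the trajectory is trapped and converges, with |x - xbar| = O(r^(1-theta)).
   The rates follow from r' <= - (c/K^2) r^(2 theta). *)
Require Import Defs.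
From mathcomp Require Import all_boot all_order all_algebra.
From mathcomp Require Import all_classical all_reals all_analysis.
From mathcomp Require Import ring lra.
Import Order.TTheory GRing.Theory Num.Theory.

Local Open Scope classical_set_scope.
Local Open Scope ring_scope.

(** * Euclidean norm *)

Section Euclidean.
Context {R : realType} {m : nat}.
Implicit Types u v w : 'rV[R]_m.

Lemma dotvC u v : dotv u v = dotv v u.
Proof. by apply: eq_bigr => i _; rewrite mulrC. Qed.

Lemma dotvDl u v w : dotv (u + v) w = dotv u w + dotv v w.
Proof. by rewrite /dotv -big_split; apply: eq_bigr => i _; rewrite mxE mulrDl. Qed.

Lemma dotvDr u v w : dotv u (v + w) = dotv u v + dotv u w.
Proof. by rewrite dotvC dotvDl !(dotvC u). Qed.

Lemma dotvZl a u v : dotv (a *: u) v = a * dotv u v.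
Proof. by rewrite /dotv mulr_sumr; apply: eq_bigr => i _; rewrite mxE mulrA. Qed.

Lemma dotvZr a u v : dotv u (a *: v) = a * dotv u v.
Proof. by rewrite dotvC dotvZl dotvC. Qed.

Lemma dotvNl u v : dotv (- u) v = - dotv u v.
Proof. by rewrite -scaleN1r dotvZl mulN1r. Qed.

Lemma dotvNr u v : dotv u (- v) = - dotv u v.
Proof. by rewrite dotvC dotvNl dotvC. Qed.

Lemma dot0v u : dotv 0 u = 0.
Proof. by rewrite -(scale0r u) dotvZl mul0r. Qed.

Lemma dotv0 u : dotv u 0 = 0.
Proof. by rewrite dotvC dot0v. Qed.

Definition dotvE := (dotvDl, dotvDr, dotvNl, dotvNr, dotvZl, dotvZr).

Lemma dotvv_ge0 u : 0 <= dotv u u.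
Proof. by apply: sumr_ge0 => i _; rewrite -expr2 sqr_ge0. Qed.

Lemma enorm_ge0 u : 0 <= enorm u.
Proof. exact: sqrtr_ge0. Qed.

Lemma sqr_enorm u : enorm u ^+ 2 = dotv u u.
Proof. by rewrite sqr_sqrtr ?dotvv_ge0. Qed.

Lemma enorm0 : enorm (0 : 'rV[R]_m) = 0.
Proof. by rewrite /enorm dot0v sqrtr0. Qed.

Lemma enormZ a u : enorm (a *: u) = `|a| * enorm u.
Proof.
by rewrite /enorm dotvZl dotvZr mulrA -expr2 sqrtrM ?sqr_ge0// sqrtr_sqr.
Qed.

Lemma enormN u : enorm (- u) = enorm u.
Proof. by rewrite -scaleN1r enormZ normrN1 mul1r. Qed.

Lemma enormBC u v : enorm (u - v) = enorm (v - u).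
Proof. by rewrite -enormN opprB. Qed.

(** Nonnegativity of the quadratic form [h a b], evaluated at the weights that expose its
    discriminant. *)
Lemma cauchy_schwarz u v : `|dotv u v| <= enorm u * enorm v.
Proof.
have h (a b : R) : 0 <= a ^+ 2 * dotv u u + 2 * a * b * dotv u v + b ^+ 2 * dotv v v.
  by have := dotvv_ge0 (a *: u + b *: v); rewrite !dotvE (dotvC v u); lra.
have hd : dotv u v ^+ 2 <= dotv u u * dotv v v.
  have [v0|v0] := eqVneq (dotv v v) 0.
    (* With [dotv v v = 0] the form is affine in [b]; these weights leave
       [- dotv u v ^+ 2 * (dotv u u + 2) >= 0]. *)
    have := h (- dotv u v) (dotv u u + 1).
    rewrite v0; have := mulr_ge0 (sqr_ge0 (dotv u v)) (dotvv_ge0 u).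
    have := sqr_ge0 (dotv u v); lra.
  have vgt0 : 0 < dotv v v by rewrite lt_neqAle eq_sym v0 dotvv_ge0.
  rewrite -subr_ge0 -(pmulr_rge0 _ vgt0).
  by have := h (dotv v v) (- dotv u v); lra.
rewrite -(@ler_pXn2r _ 2%N) ?nnegrE ?mulr_ge0 ?enorm_ge0//.
by rewrite exprMn !sqr_enorm real_normK ?num_real.
Qed.

Lemma dotv_le u v : dotv u v <= enorm u * enorm v.
Proof. exact: le_trans (ler_norm _) (cauchy_schwarz _ _). Qed.

Lemma enormD u v : enorm (u + v) <= enorm u + enorm v.
Proof.
rewrite -(@ler_pXn2r _ 2%N) ?nnegrE ?addr_ge0 ?enorm_ge0//.
rewrite sqrrD !sqr_enorm !dotvE (dotvC v u).
by have := dotv_le u v; lra.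
Qed.

Lemma enormB_le u v : enorm (u - v) <= enorm u + enorm v.
Proof. by rewrite -(enormN v) enormD. Qed.

Lemma enorm_dist w u v : enorm (u - v) <= enorm (u - w) + enorm (w - v).
Proof. by rewrite -(subrKA w u (- v)) (le_trans (enormD _ _)). Qed.

Lemma enorm_le_add u v : enorm u <= enorm v + enorm (u - v).
Proof. by rewrite -[in leLHS](subrKC v u) enormD. Qed.

Lemma normr_le_enorm u : `|u| <= enorm u.
Proof.
rewrite [leLHS]mx_normrE; apply: bigmax_le => [|[i j] _]; first exact: enorm_ge0.
rewrite -sqrtr_sqr /enorm ler_wsqrtr// ord1 /dotv (bigD1 j)//= -expr2 lerDl.
by apply: sumr_ge0 => k _; rewrite -expr2 sqr_ge0.
Qed.

(** Each coordinate is at most the sup norm. The crude factor [m.+1] stays positive for [m = 0], so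
    [nbhs_enormP] can divide by it. *)
Lemma enorm_le_normr u : enorm u <= m.+1%:R * `|u|.
Proof.
rewrite -(@ler_pXn2r _ 2%N) ?nnegrE ?mulr_ge0 ?enorm_ge0// sqr_enorm exprMn.
apply: (@le_trans _ _ (\sum_(i < m) `|u| ^+ 2)).
  apply: ler_sum => i _; rewrite -expr2 -real_normK ?num_real//.
  rewrite ler_pXn2r ?nnegrE// [leRHS]mx_normrE.
  exact: (@le_bigmax _ _ _ _ (fun ij : 'I_1 * 'I_m => `|u ij.1 ij.2|) (0, i)).
rewrite sumr_const card_ord -[leLHS]mulr_natl ler_wpM2r ?sqr_ge0//.
by rewrite -natrX ler_nat (leq_trans (leqnSn _))// leq_pmulr.
Qed.

Lemma enorm_eq0 u : enorm u = 0 -> u = 0.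
Proof.
by move=> u0; apply/normr0_eq0/le_anti; rewrite normr_ge0 -u0 normr_le_enorm.
Qed.

(** Carries topological notions, built on the sup norm, over to Euclidean estimates. *)
Lemma nbhs_enormP u (A : set 'rV[R]_m) :
  nbhs u A <-> exists2 e, 0 < e & forall v, enorm (v - u) < e -> A v.
Proof.
split=> [/nbhs_ballP[e /= e0 eA]|[e e0 eA]].
  exists e => // v uv; apply: eA; rewrite -ball_normE /=.
  by rewrite distrC (le_lt_trans (normr_le_enorm _)).
apply/nbhs_ballP; exists (e / m.+1%:R) => /=; first by rewrite divr_gt0.
move=> v; rewrite -ball_normE /= ltr_pdivlMr// mulrC distrC => h; apply: eA.
by rewrite (le_lt_trans (enorm_le_normr _)).
Qed.

Lemma cvg_enormP {T} {F : set_system T} {FF : Filter F} (h : T -> 'rV[R]_m) u :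
  h @ F --> u <-> forall e, 0 < e -> \forall t \near F, enorm (h t - u) < e.
Proof.
split=> [hu e e0|hu A /nbhs_enormP[e e0 eA]].
  have /hu := (nbhs_enormP u [set v | enorm (v - u) < e]).2 (ex_intro2 _ _ e e0 (fun _ => id)).
  by [].
by apply: filterS (hu e e0) => t /eA.
Qed.

Lemma closed_ball_compact (M : R) : compact [set u : 'rV[R]_m | enorm u <= M].
Proof.
apply: bounded_closed_compact.
  exists M; split; first exact: num_real.
  by move=> N MN u /= uM; rewrite (le_trans (normr_le_enorm _))// (le_trans uM) ?ltW.
rewrite -openC openE => u /=/negP; rewrite -ltNge => Mu.
apply/nbhs_enormP; exists (enorm u - M); first by rewrite subr_gt0.
move=> v vu /=; apply/negP; rewrite -ltNge.
by have := enorm_le_add u v; rewrite enormBC; lra.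
Qed.

End Euclidean.

(** * Dini derivatives and tangent inequalities for powers *)

Section Dini.
Context {R : realType}.
Implicit Types (psi F : R -> R) (a b c e k p t : R).

(** The upper right Dini derivative of [psi] at [t] is at most [c], phrased without a limsup. *)
Definition right_dini_le psi t c := forall e, 0 < e ->
  exists2 d, 0 < d & forall s, t < s < t + d -> psi s - psi t <= (c + e) * (s - t).

Lemma right_dini_le_weaken psi t c c' :
  c <= c' -> right_dini_le psi t c -> right_dini_le psi t c'.
Proof.
move=> cc' h e e0; have [d d0 hd] := h e e0; exists d => // s std.
by have := hd s std; case/andP: std => ts _; nra.
Qed.

Lemma right_dini_leD psi1 psi2 t c1 c2 :
  right_dini_le psi1 t c1 -> right_dini_le psi2 t c2 ->
  right_dini_le (fun s => psi1 s + psi2 s) t (c1 + c2).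
Proof.
move=> h1 h2 e e0; have e20 : 0 < e / 2 by lra.
have [d1 d10 hd1] := h1 _ e20; have [d2 d20 hd2] := h2 _ e20.
exists (Num.min d1 d2); first by rewrite lt_min d10.
move=> s /andP[ts]; rewrite -ltrBlDl lt_min => /andP[sd1 sd2].
have {}hd1 : psi1 s - psi1 t <= (c1 + e / 2) * (s - t) by apply: hd1; lra.
have {}hd2 : psi2 s - psi2 t <= (c2 + e / 2) * (s - t) by apply: hd2; lra.
lra.
Qed.

(* [c1] plays the role of the derivative of [F] at [r t]. *)
Lemma right_dini_le_comp F (r : R -> R) t c c1 : 0 <= c1 ->
  (forall s, t < s -> F (r s) - F (r t) <= c1 * (r s - r t)) ->
  right_dini_le r t c -> right_dini_le (F \o r) t (c1 * c).
Proof.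
move=> c10 hF hr e e0.
have [d d0 hd] := hr (e / (c1 + 1)) ltac:(by rewrite divr_gt0// ltr_wpDl).
exists d => // s std; have /andP[ts _] := std.
apply: (le_trans (hF s ts)).
apply: (le_trans (ler_wpM2l c10 (hd s std))).
rewrite mulrA; apply: ler_wpM2r; first by rewrite subr_ge0 ltW.
by rewrite mulrDr lerD2l mulrA ler_pdivrMr ?ltr_wpDl//; nra.
Qed.

Lemma right_dini_le_linear k t : right_dini_le (fun s => k * s) t k.
Proof.
by move=> e e0; exists 1 => // s /andP[ts _]; nra.
Qed.

(* The one-sided estimate is only required while [psi] stays below the barrier
   [psi a + gam]; this makes the lemma usable for trapping a trajectory. *)
Lemma right_dini_nonincreasing psi a b gam : a <= b -> 0 < gam ->
  (forall t e, a < t <= b -> 0 < e ->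
    exists2 d, 0 < d & forall s, a <= s -> t - d < s < t -> psi t <= psi s + e) ->
  (forall t, a <= t < b -> psi t < psi a + gam -> right_dini_le psi t 0) ->
  psi b <= psi a.
Proof.
move=> ab gam0 hl hr.
(* It suffices to bound [psi] by lines of small slope [e]; the condition [e * (b - a) < gam] keeps
   them below the barrier. *)
suff key e : 0 < e -> e * (b - a) < gam -> psi b <= psi a + e * (b - a).
  apply/ler_addgt0Pr => e e0.
  set e' := Num.min e (gam / 2) / (b - a + 1).
  have ba1 : 0 < b - a + 1 by lra.
  have m0 : 0 < Num.min e (gam / 2) by rewrite lt_min e0; lra.
  have e'0 : 0 < e' by rewrite divr_gt0.
  have e'm : e' * (b - a) <= Num.min e (gam / 2).
    by rewrite /e' mulrAC ler_pdivrMr//; apply: ler_wpM2l; lra.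
  have := e'm; rewrite le_min => /andP[h1 h2].
  apply: (le_trans (key e' e'0 _)); lra.
move=> e0 ega.
pose P t := forall s, a <= s <= t -> psi s <= psi a + e * (s - a).
(* The supremum [c] of [S] is the last time up to which the line dominates [psi]; the aim is
   [c = b]. *)
pose S := [set t | a <= t <= b /\ P t].
have Sa : S a.
  split; first by rewrite lexx.
  by move=> s /le_anti <-; rewrite subrr mulr0 addr0.
have hS : has_sup S by split; [exists a | exists b => t [/andP[]]].
set c := sup S.
have ac : a <= c by apply: ub_le_sup => //; exact: hS.2.
have cb : c <= b by apply: ge_sup; [exists a | move=> t [/andP[]]].
have Pltc s : a <= s -> s < c -> psi s <= psi a + e * (s - a).
  move=> as_ sc; have cs0 : 0 < c - s by rewrite subr_gt0.
  have [t [_ Pt] st] := sup_adherent cs0 hS.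
  by apply: Pt; rewrite as_ /=; move: st; rewrite -/c; lra.
(* The bound passes to [c] itself by [hl], which is lower semicontinuity from the left. *)
have Pc : P c.
  move=> s /andP[as_ sc]; have [sc'|cs] := ltP s c; first exact: Pltc.
  have -> : s = c by apply/le_anti; rewrite sc cs.
  have [->|ac'] := eqVneq a c; first by rewrite subrr mulr0 addr0.
  have {}ac' : a < c by rewrite lt_neqAle ac'.
  apply/ler_addgt0Pr => e1 e10.
  have [d d0 hd] := hl c e1 ltac:(by rewrite ac') e10.
  have [u /andP[u1 u2]] : exists u, Num.max a (c - d) < u < c.
    have mc : Num.max a (c - d) < c by rewrite gt_max ac' /=; lra.
    by exists ((Num.max a (c - d) + c) / 2); apply/andP; split; lra.
  move: u1; rewrite gt_max => /andP[u1 u3].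
  have := hd u (ltW u1) ltac:(by rewrite u3).
  have := Pltc u (ltW u1) u2; nra.
have [cltb|bc] := ltP c b; last first.
  have <- : c = b by apply/le_anti; rewrite cb.
  by apply: Pc; rewrite ac lexx.
exfalso.
have pc : psi c <= psi a + e * (c - a) by apply: Pc; rewrite ac lexx.
(* At [c] the function is below the barrier, so the Dini estimate holds there and pushes the bound
   beyond [c], a contradiction. *)
have [d d0 hd] := hr c ltac:(by rewrite ac) ltac:(nra) e e0.
pose u := Num.min (c + d / 2) b.
have cu : c < u by rewrite lt_min cltb andbT; lra.
have ucd : u <= c + d / 2 by rewrite ge_min lexx.
have ub_ : u <= b by rewrite ge_min lexx orbT.
suff : S u by move=> Su; have := ub_le_sup hS.2 Su; rewrite -/c; lra.
split; first by apply/andP; split; lra.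
move=> s /andP[as_ su]; have [sc|cs] := leP s c; first by apply: Pc; rewrite as_.
have := hd s ltac:(by apply/andP; split; lra); lra.
Qed.

Lemma ln_le_subr1 a : 0 < a -> ln a <= a - 1.
Proof. by move=> a0; rewrite -[in leLHS](subrKC 1 a) le_ln1Dx//; lra. Qed.

(** With [c] the right-hand side, apply [ln y <= y - 1] to [a / c] and to [c^-1]: the combination
    with weights [p] and [1 - p] has right-hand side 0, which gives [p * ln a <= ln c]. *)
Lemma powR_bernoulli p a : 0 < p < 1 -> 0 < a -> a `^ p <= 1 + p * (a - 1).
Proof.
move=> /andP[p0 p1] a0; set c := 1 + p * (a - 1).
have c0 : 0 < c by rewrite /c; nra.
rewrite -ler_ln ?posrE ?powR_gt0// ln_powR.
have h1 : ln a - ln c <= a / c - 1 by rewrite -ln_div ?posrE// ln_le_subr1// divr_gt0.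
have h2 : - ln c <= c^-1 - 1 by rewrite -lnV ?posrE// ln_le_subr1// invr_gt0.
have h3 : p * (a / c - 1) + (1 - p) * (c^-1 - 1) = 0.
  have -> : p * (a / c - 1) + (1 - p) * (c^-1 - 1) = (1 + p * (a - 1)) / c - 1 by ring.
  by rewrite divff ?subrr ?gt_eqF.
nra.
Qed.

(** Follows from [1 + y <= expR y] at [y = p * ln a], since a negative [p] reverses
    [ln a <= a - 1]. *)
Lemma powR_bernoulliN p a : p < 0 -> 0 < a -> 1 + p * (a - 1) <= a `^ p.
Proof.
move=> p0 a0; rewrite /powR gt_eqF//.
apply: (le_trans _ (expR_ge1Dx _)); rewrite lerD2l.
have := ln_le_subr1 a a0; nra.
Qed.

(** The function [a]^ p / p[is concave with derivative]a [^ (p - 1)] for either sign of [p];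
    homogeneity reduces this to Bernoulli at [b / a]. Positive [p] serves finite-time convergence,
    negative [p] the polynomial rate. *)
Lemma powR_tangent p a b : p < 1 -> p != 0 -> 0 < a -> 0 < b ->
  b `^ p / p - a `^ p / p <= a `^ (p - 1) * (b - a).
Proof.
move=> p1 p0 a0 b0; rewrite -mulrBl.
have ba : 0 < b / a by rewrite divr_gt0.
have -> : b `^ p = a `^ p * (b / a) `^ p.
  by rewrite -powRM ?ltW// mulrCA divff ?mulr1// gt_eqF.
have -> : a `^ (p - 1) * (b - a) = a `^ p * (b / a - 1).
  rewrite powRB ?(gt_eqF a0) ?implybT// powRr1 ?ltW// -mulrA; congr (_ * _).
  by rewrite mulrC mulrBl divff// gt_eqF.
have ap0 : 0 < a `^ p by rewrite powR_gt0.
have [pl|pg|pe] := ltgtP p 0; last by rewrite pe eqxx in p0.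
  rewrite ler_ndivrMr//; have := powR_bernoulliN p (b / a) pl ba; nra.
rewrite ler_pdivrMr//.
have := powR_bernoulli p (b / a) ltac:(by rewrite pg) ba; nra.
Qed.

(** Allowing [b = 0] matters because the energy gap may vanish at a later time. *)
Lemma powR_tangent0 p a b : 0 < p < 1 -> 0 < a -> 0 <= b ->
  b `^ p / p - a `^ p / p <= a `^ (p - 1) * (b - a).
Proof.
move=> /andP[p0 p1] a0; rewrite le_eqVlt => /predU1P[<-|b0]; last first.
  by apply: powR_tangent => //; rewrite gt_eqF.
rewrite powR0 ?gt_eqF// mul0r !sub0r mulrN lerN2.
rewrite powRB ?(gt_eqF a0) ?implybT// powRr1 ?(ltW a0)// divfK ?gt_eqF//.
by apply: ler_peMr; [exact: powR_ge0|rewrite invf_ge1// ltW].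
Qed.

Lemma derive1_powRZ k p a : 0 < a ->
  derive1 (fun s => k * s `^ p) a = k * (p * a `^ (p - 1)).
Proof.
move=> a0; rewrite derive1E; apply: derive_val.
apply: (@is_deriveZ R R R (fun s => s `^ p) k a 1).
exact: is_derive1_powR.
Qed.

End Dini.

(** * Dissipative trajectories under a Lojasiewicz inequality *)

Section Trajectory.
Context {R : realType} {m : nat}.
Variables (x q : R -> 'rV[R]_m) (r : R -> R) (c0 : R).
Hypothesis c0_gt0 : 0 < c0.
Hypothesis x_dini : forall t e, 0 <= t -> 0 < e -> exists2 d, 0 < d &
  forall s, t < s < t + d -> enorm (x s - x t) <= (enorm (q t) + e) * (s - t).
Hypothesis x_cont : forall t e, 0 <= t -> 0 < e -> exists2 d, 0 < d &
  forall s, 0 <= s -> `|s - t| < d -> enorm (x s - x t) <= e.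
Hypothesis r_ge0 : forall t, 0 <= t -> 0 <= r t.
Hypothesis r_noninc : forall s t, 0 <= s -> s <= t -> r t <= r s.
Hypothesis r_dini : forall t, 0 <= t ->
  right_dini_le r t (- (c0 * enorm (q t) ^+ 2)).

Lemma dist_right_dini T t : 0 <= t ->
  right_dini_le (fun s => enorm (x s - x T)) t (enorm (q t)).
Proof.
move=> t0 e e0; have [d d0 hd] := x_dini t e t0 e0; exists d => // s std.
by have := hd s std; have := enorm_dist (x t) (x s) (x T); lra.
Qed.

(** A nonnegative [r] cannot decrease from 0, so the dissipation [c0 * enorm (q t) ^+ 2] must
    vanish. *)
Lemma velocity_eq0 t : 0 <= t -> r t = 0 -> enorm (q t) = 0.
Proof.
move=> t0 rt.
suff h : c0 * enorm (q t) ^+ 2 <= 0.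
  have : enorm (q t) ^+ 2 <= 0 by rewrite -(pmulr_rle0 _ c0_gt0).
  by move=> h2; apply/eqP; rewrite -sqrf_eq0; apply/eqP/le_anti; rewrite h2 sqr_ge0.
apply/ler_addgt0Pr => e e0; have [d d0 hd] := r_dini t t0 e e0.
have := hd (t + d / 2) ltac:(by apply/andP; split; lra).
have := r_ge0 (t + d / 2) ltac:(lra); rewrite rt.
have -> : t + d / 2 - t = d / 2 by lra.
have d20 : 0 < d / 2 by lra.
rewrite subr0 add0r => h1 h2; have := le_trans h1 h2.
rewrite pmulr_lge0//; lra.
Qed.

(* If [r^theta <= K |q|] then [K / ((1 - theta) c0) r^(1 - theta)] plus the
   distance travelled is nonincreasing. *)
Lemma length_le theta K T gam : 0 < theta < 1 -> 0 < K -> 0 <= T -> 0 < gam ->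
  (forall t, T <= t ->
     enorm (x t - x T) < K / ((1 - theta) * c0) * r T `^ (1 - theta) + gam ->
     r t `^ theta <= K * enorm (q t)) ->
  forall t, T <= t ->
    enorm (x t - x T) <= K / ((1 - theta) * c0) * r T `^ (1 - theta).
Proof.
move=> /andP[th0 th1] K0 T0 gam0 hKL t Tt.
have p01 : 0 < 1 - theta < 1 by lra.
have p0 : 0 < 1 - theta by lra.
pose G s := K / c0 * (s `^ (1 - theta) / (1 - theta)).
have GE s : G s = K / ((1 - theta) * c0) * s `^ (1 - theta).
  by rewrite /G invfM; ring.
have G0 s : 0 <= G s by rewrite /G !mulr_ge0 ?powR_ge0 ?invr_ge0 ?ltW.
have Kc0 : 0 < K / c0 by rewrite divr_gt0.
have Gmono a b : 0 <= b -> b <= a -> G b <= G a.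
  move=> b0 ba; rewrite !GE; apply: ler_wpM2l; last first.
    by apply: ge0_ler_powR; rewrite ?nnegrE ?(ltW p0)// (le_trans b0).
  by rewrite divr_ge0 ?mulr_ge0 ?ltW.
pose psi s := G (r s) + enorm (x s - x T).
suff : psi t <= psi T.
  by rewrite /psi subrr enorm0 addr0 -GE; have := G0 (r t); lra.
apply: (@right_dini_nonincreasing _ psi T t gam) => //.
- move=> s e /andP[Ts st] e0; have s0 : 0 <= s by lra.
  have [d d0 hd] := x_cont s e s0 e0; exists d => // u Tu /andP[su us].
  have u0 : 0 <= u by lra.
  rewrite /psi; have := Gmono _ _ (r_ge0 s s0) (r_noninc u s u0 (ltW us)).
  have := hd u u0; rewrite ltr_distlC; move/(_ ltac:(lra)).
  by have := enorm_dist (x u) (x s) (x T); rewrite (enormBC (x s) (x u)); lra.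
move=> s /andP[Ts st] spsi; have s0 : 0 <= s by lra.
(* Where the gap vanishes, [G] has infinite slope; the chain rule is replaced by monotonicity of
   [G \o r] and zero velocity. *)
have [rs0|rs_neq0] := eqVneq (r s) 0.
  have -> : 0 = 0 + enorm (q s) by rewrite velocity_eq0// addr0.
  apply: right_dini_leD; last exact: dist_right_dini.
  move=> e e0; exists 1 => // u /andP[su _].
  have u0 : 0 <= u by lra.
  have : G (r u) <= G (r s) by apply: Gmono; [exact: r_ge0|apply: r_noninc => //; exact: ltW].
  by move=> h; have : 0 <= (0 + e) * (u - s) by [apply: mulr_ge0; lra]; lra.
have rs : 0 < r s by rewrite lt_neqAle eq_sym rs_neq0 r_ge0.
(* Since [G] is nonnegative, the barrier on [psi] also bounds the distance from [x T], so [hKL]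
   applies at [s]. *)
have hs : r s `^ theta <= K * enorm (q s).
  apply: hKL => //; move: spsi.
  by rewrite /psi subrr enorm0 addr0 -GE; have := G0 (r s); lra.
apply: (@right_dini_le_weaken _ _ _
  (K / c0 * r s `^ (- theta) * (- (c0 * enorm (q s) ^+ 2)) + enorm (q s))).
  have pth : 0 < r s `^ theta by rewrite powR_gt0.
  rewrite powRN -lerBrDr sub0r -(ler_pM2l pth).
  have -> : r s `^ theta * (K / c0 / r s `^ theta * - (c0 * enorm (q s) ^+ 2)) =
    - (K * enorm (q s) ^+ 2).
    by field; rewrite !gt_eqF.
  have := ler_wpM2r (enorm_ge0 (q s)) hs; lra.
apply: right_dini_leD; last exact: dist_right_dini.
apply: (@right_dini_le_comp _ G r).
- by rewrite mulr_ge0 ?powR_ge0// ltW.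
- move=> u su.
  have := @powR_tangent0 _ (1 - theta) (r s) (r u) p01 rs (r_ge0 u ltac:(lra)).
  have -> : 1 - theta - 1 = - theta by ring.
  by move/(ler_wpM2l (ltW Kc0)); rewrite /G; lra.
- exact: r_dini.
Qed.

(** Separation of variables: [F'] acts as the derivative of a concave [F], so [F \o r] has Dini
    derivative at most [- k] as long as [r] is positive. *)
Lemma concave_rate (F F' : R -> R) k T S :
  (forall a, 0 < a -> 0 <= F' a) ->
  (forall a b, 0 < a -> 0 < b -> F b - F a <= F' a * (b - a)) ->
  0 <= T -> T <= S -> (forall t, T <= t <= S -> 0 < r t) ->
  (forall t, T <= t <= S -> k <= F' (r t) * (c0 * enorm (q t) ^+ 2)) ->
  F (r S) <= F (r T) - k * (S - T).
Proof.
move=> F'0 tangent T0 TS rpos hk.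
pose psi s := F (r s) + k * s.
suff : psi S <= psi T by rewrite /psi; lra.
apply: (@right_dini_nonincreasing _ psi T S 1) => //.
- move=> s e /andP[Ts sS] e0.
  exists (e / (`|k| + 1)); first by rewrite divr_gt0// ltr_wpDl.
  move=> u Tu /andP[]; rewrite ltrBlDr -ltrBlDl => hu us.
  have hF : F (r s) <= F (r u).
    rewrite -subr_le0; apply: le_trans (tangent (r u) (r s) _ _) _.
    + by apply: rpos; lra.
    + by apply: rpos; lra.
    + rewrite mulr_ge0_le0 ?F'0 ?rpos ?subr_le0 ?r_noninc//; lra.
  rewrite ltr_pdivlMr ?ltr_wpDl// in hu.
  rewrite /psi; have : k * (s - u) <= `|k| * (s - u).
    by apply: ler_wpM2r; [lra|exact: ler_norm].
  lra.
move=> s /andP[Ts sS] _; have s0 : 0 <= s by lra.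
have sTS : T <= s <= S by rewrite Ts ltW.
apply: (@right_dini_le_weaken _ _ _ (F' (r s) * (- (c0 * enorm (q s) ^+ 2)) + k)).
  by have := hk s sTS; lra.
apply: right_dini_leD; last exact: right_dini_le_linear.
move=> e e0.
have ee : 0 < e / (F' (r s) + 1) by rewrite divr_gt0// ltr_wpDl// F'0// rpos.
have [d d0 hd] := r_dini s s0 _ ee.
exists (Num.min d (S - s)); first by rewrite lt_min d0 subr_gt0.
move=> u /andP[su]; rewrite -ltrBlDl lt_min => /andP[ud uS].
have F's := F'0 _ (rpos s sTS).
apply: le_trans (tangent (r s) (r u) (rpos s sTS) (rpos u _)) _; first by lra.
apply: (le_trans (ler_wpM2l F's (hd u _))); first by lra.
rewrite mulrA; apply: ler_wpM2r; first by rewrite subr_ge0 ltW.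
by rewrite mulrDr lerD2l mulrA ler_pdivrMr ?ltr_wpDl//; nra.
Qed.

(** If the speed exceeded [e] at a late time, the Lipschitz bound would keep it above [e / 2] for a
    duration [d], and [r] would lose [k * d], more than remains. *)
Lemma velocity_cvg0 L e : 0 <= L ->
  (forall s t, 0 <= s -> 0 <= t -> enorm (q s - q t) <= L * `|s - t|) ->
  (forall e', 0 < e' -> exists2 T, 0 <= T & r T < e') ->
  0 < e -> exists2 T, 0 <= T & forall t, T <= t -> enorm (q t) <= e.
Proof.
move=> L0 qL rlim e0.
pose d := e / (2 * (L + 1)).
have d0 : 0 < d by rewrite divr_gt0// mulr_gt0// ltr_wpDl.
have Ld : L * d <= e / 2.
  by rewrite /d mulrA ler_pdivrMr ?mulr_gt0 ?ltr_wpDl//; nra.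
pose k := c0 * (e / 2) ^+ 2.
have k0 : 0 < k by rewrite mulr_gt0// exprn_gt0// divr_gt0.
have [T T0 rT] := rlim (k * d) ltac:(by rewrite mulr_gt0).
exists T => // t Tt; rewrite leNgt; apply/negP => qt.
have t0 : 0 <= t by lra.
suff : r (t + d) + k * (t + d) <= r t + k * t.
  have := r_ge0 (t + d) ltac:(lra); have := r_noninc T t T0 Tt; lra.
apply: (@right_dini_nonincreasing _ (fun s => r s + k * s) t (t + d) 1) => //.
- lra.
- move=> s e1 /andP[ts sd] e10; exists (e1 / k); first by rewrite divr_gt0.
  move=> u tu /andP[su us]; have := r_noninc u s ltac:(lra) (ltW us).
  have : k * (s - u) <= e1 by rewrite mulrC -ler_pdivlMr//; lra.
  lra.
move=> s /andP[ts sd] _; have s0 : 0 <= s by lra.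
apply: (@right_dini_le_weaken _ _ _ (- (c0 * enorm (q s) ^+ 2) + k)); last first.
  by apply: right_dini_leD; [exact: r_dini|exact: right_dini_le_linear].
suff h : e / 2 <= enorm (q s).
  suff : k <= c0 * enorm (q s) ^+ 2 by lra.
  by apply: ler_wpM2l; [exact: ltW|rewrite ler_pXn2r ?nnegrE ?enorm_ge0// divr_ge0 ?ltW].
have := qL t s t0 s0; have := enorm_le_add (q t) (q s).
have : L * `|t - s| <= L * d.
  by apply: ler_wpM2l => //; rewrite distrC ger0_norm ?subr_ge0//; lra.
lra.
Qed.

(** * Convergence rates in the three ranges of the exponent *)

Section Rates.
Variables (xbar : 'rV[R]_m) (theta K T0 : R).
Hypothesis x_cvg : forall e, 0 < e ->
  exists T, forall t, T <= t -> enorm (x t - xbar) < e.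
Hypothesis theta01 : 0 < theta < 1.
Hypothesis K_gt0 : 0 < K.
Hypothesis T0_ge0 : 0 <= T0.
Hypothesis lojasiewicz : forall t, T0 <= t -> r t `^ theta <= K * enorm (q t).

Let A := K / ((1 - theta) * c0).

Let A_gt0 : 0 < A.
Proof. by have /andP[_ th1] := theta01; rewrite divr_gt0// mulr_gt0// subr_gt0. Qed.

(** The length bound started at [t], with its end time sent to infinity; the inequality holds at all
    times after [T0], so the barrier height is arbitrary. *)
Lemma dist_limit_le t : T0 <= t -> enorm (x t - xbar) <= A * r t `^ (1 - theta).
Proof.
move=> Tt; have t0 := le_trans T0_ge0 Tt.
apply/ler_addgt0Pr => e e0; have [T hT] := x_cvg e e0.
pose s := Num.max T t.
have ts : t <= s by rewrite le_max lexx orbT.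
have hs : enorm (x s - xbar) < e by apply: hT; rewrite le_max lexx.
have : enorm (x s - x t) <= A * r t `^ (1 - theta).
  apply: (length_le theta K t 1) => // u tu _; apply: lojasiewicz.
  exact: le_trans tu.
by have := enorm_dist (x s) (x t) xbar; rewrite (enormBC (x t) (x s)); lra.
Qed.

(** Squaring the Lojasiewicz inequality turns the dissipation into [r' <= - (c0 / K ^+ 2) * r]^ (2 *
    theta)[, and]F[is an antiderivative of]a [^ (- (2 * theta))]. *)
Lemma gap_decay (F : R -> R) T S :
  (forall a b, 0 < a -> 0 < b -> F b - F a <= a `^ (- (2 * theta)) * (b - a)) ->
  T0 <= T -> T <= S -> 0 < r S ->
  F (r S) <= F (r T) - c0 / K ^+ 2 * (S - T).
Proof.
move=> tangent TT TS rS.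
have rpos t : T <= t <= S -> 0 < r t.
  move=> /andP[Tt tS]; apply: lt_le_trans rS (r_noninc t S _ tS).
  exact: le_trans (le_trans T0_ge0 TT) Tt.
apply: (@concave_rate F (fun a => a `^ (- (2 * theta)))) => //.
- by move=> a _; exact: powR_ge0.
- exact: le_trans TT.
move=> t tTS; have rt := rpos t tTS; have /andP[Tt' _] := tTS.
have Tt : T0 <= t := le_trans TT Tt'.
have th2 : r t `^ (2 * theta) <= K ^+ 2 * enorm (q t) ^+ 2.
  rewrite mulrC powRrM powR_mulrn ?powR_ge0// -exprMn.
  rewrite ler_pXn2r ?nnegrE ?powR_ge0 ?mulr_ge0 ?enorm_ge0 ?(ltW K_gt0)//.
  exact: lojasiewicz.
have p0 : 0 < r t `^ (2 * theta) by rewrite powR_gt0.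
rewrite powRN [leRHS]mulrC ler_pdivlMr// mulrAC ler_pdivrMr ?exprn_gt0//.
by have := ler_wpM2l (ltW c0_gt0) th2; lra.
Qed.

(** Here [1 - 2 * theta > 0], so [F] is bounded below by 0 and cannot decrease linearly forever: the
    gap reaches 0, and then the distance does. *)
Lemma finite_time : theta < 1 / 2 ->
  exists T, 0 <= T /\ forall s, T <= s -> x s = xbar.
Proof.
move=> th; have /andP[th0 th1] := theta01.
pose p := 1 - 2 * theta.
have p01 : 0 < p < 1 by rewrite /p; lra.
have p0 : p != 0 by rewrite gt_eqF//; case/andP: p01.
have k0 : 0 < c0 / K ^+ 2 by rewrite divr_gt0// exprn_gt0.
pose F a : R := a `^ p / p.
have F0 a : 0 <= F a by rewrite divr_ge0 ?powR_ge0//; lra.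
(* By this time the linear decrease would exceed [F (r T0)]; the extra 1 makes the contradiction
   strict. *)
pose S := T0 + (F (r T0) / (c0 / K ^+ 2) + 1).
have TS : T0 <= S by rewrite lerDl addr_ge0// divr_ge0 ?F0// ltW.
have S0 : 0 <= S := le_trans T0_ge0 TS.
have rS : r S = 0.
  apply/eqP; apply: contraT => rS0.
  have rS : 0 < r S by rewrite lt_neqAle eq_sym rS0 r_ge0.
  have := gap_decay F T0 S _ (lexx _) TS rS.
  have tg a b : 0 < a -> 0 < b -> F b - F a <= a `^ (- (2 * theta)) * (b - a).
    move=> a0 b0; have -> : - (2 * theta) = p - 1 by rewrite /p; ring.
    by apply: powR_tangent => //; case/andP: p01.
  move=> /(_ tg).
  have -> : c0 / K ^+ 2 * (S - T0) = F (r T0) + c0 / K ^+ 2.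
    by rewrite /S addrAC subrr add0r mulrDr mulr1 mulrC divfK// gt_eqF.
  by have := F0 (r S); lra.
exists S; split=> // s Ss; apply/eqP; rewrite -subr_eq0; apply/eqP/enorm_eq0.
have rs : r s = 0.
  apply/le_anti; rewrite r_ge0 ?(le_trans S0)// andbT -rS.
  exact: r_noninc.
apply/le_anti; rewrite enorm_ge0 andbT.
have := dist_limit_le s (le_trans TS Ss).
by rewrite rs powR0 ?mulr0// subr_eq0 gt_eqF.
Qed.

(** The antiderivative is [ln], so [ln (r t)] decreases with slope [k]; the square root in
    [dist_limit_le] halves it. *)
Lemma exponential_rate : theta = 1 / 2 ->
  exists a b, [/\ 0 < a, 0 < b & forall t, T0 <= t ->
    enorm (x t - xbar) <= a * expR (- b * t)].
Proof.
move=> th; pose k := c0 / K ^+ 2.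
have k0 : 0 < k by rewrite divr_gt0// exprn_gt0.
(* If [r T0 = 0], the default value of [ln] enters this constant, harmlessly: then [r t = 0] as well
   and the distance is 0. *)
exists (A * expR ((ln (r T0) + k * T0) / 2)), (k / 2); split.
- by rewrite mulr_gt0// expR_gt0.
- by rewrite divr_gt0.
move=> t Tt; have t0 := le_trans T0_ge0 Tt.
apply: (le_trans (dist_limit_le t Tt)).
rewrite -[leRHS]mulrA; apply: ler_wpM2l; first exact: ltW.
have [->|rt0] := eqVneq (r t) 0.
  by rewrite powR0 ?mulr_ge0 ?expR_ge0//; rewrite th; lra.
have rt : 0 < r t by rewrite lt_neqAle eq_sym rt0 r_ge0.
have tg a b : 0 < a -> 0 < b -> ln b - ln a <= a `^ (- (2 * theta)) * (b - a).
  move=> a0 b0; rewrite th mulrCA divff// mulr1 powRN powRr1 ?(ltW a0)//.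
  rewrite -ln_div ?posrE//; apply: (le_trans (ln_le_subr1 _ _)).
    by rewrite divr_gt0.
  by rewrite mulrBr mulVf ?gt_eqF// mulrC.
have h := gap_decay (@ln R) T0 t tg (lexx _) Tt rt; rewrite -/k in h.
rewrite /powR (negbTE rt0) -expRD ler_expR th; lra.
Qed.

Lemma polynomial_rate : 1 / 2 < theta ->
  exists c d, [/\ 0 < c, 0 < d & forall t, 2 * T0 + 1 <= t ->
    enorm (x t - xbar) <= (c * t + d) `^ (- ((1 - theta) / (2 * theta - 1)))].
Proof.
move=> th; have /andP[_ th1] := theta01.
pose p := 1 - 2 * theta.
have pN : p < 0 by rewrite /p; lra.
pose sg := (1 - theta) / (2 * theta - 1).
have sg0 : 0 < sg by rewrite divr_gt0//; lra.
pose k := (2 * theta - 1) * (c0 / K ^+ 2).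
have k0 : 0 < k by rewrite mulr_gt0 ?divr_gt0 ?exprn_gt0//; lra.
pose c := A `^ (- sg^-1) * (k / 2).
have c_gt0 : 0 < c by rewrite mulr_gt0 ?(powR_gt0 _ A_gt0)// divr_gt0.
exists c, c; split=> // t tT; have Tt : T0 <= t by have := T0_ge0; lra.
have t0 := le_trans T0_ge0 Tt.
apply: (le_trans (dist_limit_le t Tt)).
have [->|rt0] := eqVneq (r t) 0.
  by rewrite powR0 ?mulr0 ?powR_ge0//; lra.
have rt : 0 < r t by rewrite lt_neqAle eq_sym rt0 r_ge0.
have tangent a b : 0 < a -> 0 < b ->
    b `^ p / p - a `^ p / p <= a `^ (- (2 * theta)) * (b - a).
  move=> a0 b0; have -> : - (2 * theta) = p - 1 by rewrite /p; ring.
  by apply: powR_tangent => //; [lra|rewrite lt_eqF].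
have h := gap_decay (fun a => a `^ p / p) T0 t tangent (lexx _) Tt rt.
(* For [t >= 2 * T0 + 1] one has [t - T0 >= (t + 1) / 2], which removes [T0] from the linear lower
   bound. *)
pose Y := k / 2 * (t + 1).
have Y0 : 0 < Y by rewrite mulr_gt0 ?divr_gt0//; lra.
have hY : Y <= r t `^ p.
  have : r T0 `^ p + k * (t - T0) <= r t `^ p.
    move: h => /=; rewrite (ler_ndivrMr _ _ pN) mulrBl divfK ?lt_eqF//.
    have -> : c0 / K ^+ 2 * (t - T0) * p = - (k * (t - T0)) by rewrite /k /p; ring.
    lra.
  have := powR_ge0 (r T0) p.
  have : 0 <= k / 2 * (t - (2 * T0 + 1)) by rewrite mulr_ge0 ?divr_ge0 ?subr_ge0// ltW.
  rewrite /Y; lra.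
have -> : r t `^ (1 - theta) = (r t `^ p) `^ (- sg).
  rewrite -powRrM; congr (_ `^ _); rewrite /p /sg; field.
  by rewrite gt_eqF//; lra.
have -> : c * t + c = A `^ (- sg^-1) * Y by rewrite /c /Y; ring.
rewrite powRM ?powR_ge0 ?(ltW Y0)// -[(A `^ _) `^ _]powRrM mulrNN mulVf ?gt_eqF//.
rewrite powRr1 ?(ltW A_gt0)//; apply: ler_wpM2l; first exact: ltW.
rewrite !powRN lef_pV2 ?posrE ?powR_gt0//.
by apply: ge0_ler_powR; rewrite ?nnegrE ?powR_ge0 ?(ltW sg0) ?(ltW Y0).
Qed.

End Rates.

End Trajectory.

(** * Proximal points and subgradients *)

Section Objective.
Context {R : realType} {m : nat}.
Implicit Types (u v w y p : 'rV[R]_m) (h f : 'rV[R]_m -> \bar R).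

Lemma diff_gradE (g : 'rV[R]_m -> R) u v : differentiable g u ->
  'd g u v = dotv (grad g u) v.
Proof.
move=> dg; rewrite [in LHS](row_sum_delta v) linear_sum.
by apply: eq_bigr => i _; rewrite linearZ mxE mulrC.
Qed.

(** The mean value theorem on the segment gives [beta] instead of the usual [beta / 2]; the constant
    enters only second-order terms and the test [beta < 1 / (2 * eta)]. *)
Lemma gradient_quadratic_bound (g : 'rV[R]_m -> R) (beta : R) u v :
  (forall u, differentiable g u) -> 0 <= beta ->
  (forall u v, enorm (grad g u - grad g v) <= beta * enorm (u - v)) ->
  `|g v - g u - dotv (grad g u) (v - u)| <= beta * enorm (v - u) ^+ 2.
Proof.
move=> dg beta0 lip; set d := v - u.
pose k (s : R) := g (u + s *: d).
have E (s : R) : (fun e : R => e^-1 *: (k (e *: 1 + s) - k s)) =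
    (fun e : R => e^-1 *: (g (e *: d + (u + s *: d)) - g (u + s *: d))).
  apply/funext => e; rewrite /k; congr (_ *: (g _ - _)).
  by rewrite scalerDl -[e *: 1]/(e * 1) mulr1 addrCA addrA.
have dk (s : R) : is_derive s 1 k (dotv (grad g (u + s *: d)) d).
  have dgs := dg (u + s *: d).
  split; first by rewrite /derivable E; exact: diff_derivable.
  by rewrite /derive E -diff_gradE// -deriveE.
have [|c /itvP c01 kE] := @MVT _ k _ 0 1 ltr01 (fun s _ => dk s).
  by apply: derivable_within_continuous => s _; exact: ex_derive.
have -> : g v - g u = dotv (grad g (u + c *: d)) d.
  by move: kE; rewrite subr0 mulr1 => <-; rewrite /k scale1r scale0r addr0 subrKC.
rewrite -dotvNl -dotvDl (le_trans (cauchy_schwarz _ _))//.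
rewrite expr2 mulrA ler_wpM2r ?enorm_ge0// (le_trans (lip _ _))// ler_wpM2l//.
rewrite addrAC subrr add0r enormZ ler_piMl ?enorm_ge0//.
by rewrite ger0_norm ?c01.
Qed.

(** Weierstrass: the sublevel sets [D w] are nested, hence generate a filter, and lower
    semicontinuity makes any cluster point a minimiser on [K]. The hypothesis outside [K] makes it
    global. *)
Lemma lsc_argmin h (K : set 'rV[R]_m) u0 :
  lower_semicontinuous h -> (forall u, h u != -oo%E) ->
  compact K -> K u0 -> (forall u, ~ K u -> (h u0 <= h u)%E) ->
  argmin h !=set0.
Proof.
move=> lsc hNy cK Ku0 out.
pose D w := [set u | K u /\ (h u <= h w)%E].
have FF : ProperFilter (filter_from K D).
  apply: filter_from_proper; last by move=> w Kw; exists w; split.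
  apply: filter_from_filter; first by exists u0.
  move=> v w Kv Kw; have [vw|/ltW wv] := leP (h v) (h w).
    by exists v => // u [Ku uv]; split; split=> //; exact: le_trans vw.
  by exists w => // u [Ku uv]; split; split=> //; exact: le_trans wv.
have [c [Kc clc]] : K `&` cluster (filter_from K D) !=set0.
  by apply: cK; exists u0 => // u [].
have cmin w : K w -> (h c <= h w)%E.
  move=> Kw; rewrite leNgt; apply/negP => wc.
  have wfin : h w \is a fin_num.
    by rewrite fin_numE hNy lt_eqF// (lt_le_trans wc)// leey.
  have [|V cV VD] := lsc c (fine (h w)); first by rewrite fineK.
  have [|u [[_ uw] Vu]] := clc (D w) V _ cV; first by exists w.
  by have := VD u Vu; rewrite fineK// ltNge uw.
exists c => w; have [/cmin//|/out] := pselect (K w).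
exact: le_trans (cmin _ Ku0).
Qed.

Lemma lsc_add_fin f (phi : 'rV[R]_m -> R) : lower_semicontinuous f ->
  (forall u e, 0 < e -> nbhs u [set v | phi u - e < phi v]) ->
  lower_semicontinuous (fun u => f u + (phi u)%:E)%E.
Proof.
move=> lf lphi u a aE.
have [e e0 ae] : exists2 e : R, 0 < e & ((a - phi u + e)%:E < f u)%E.
  case: (f u) aE => [b| |]; last by rewrite ltNge leNye.
    rewrite -EFinD lte_fin => ab; exists ((b + phi u - a) / 2); first lra.
    by rewrite lte_fin; lra.
  by exists 1 => //; rewrite ltry.
have [V uV VP] := lf u _ ae; exists (V `&` [set v | phi u - e < phi v]).
  by apply: filterI => //; exact: lphi.
move=> v [/VP Vv /= ph].
case: (f v) Vv => [b| |]; [|by rewrite addye ?ltry|by rewrite ltNge leNye].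
by rewrite -EFinD !lte_fin; lra.
Qed.

Lemma sqr_enormB_ge u v y :
  enorm (u - y) ^+ 2 - 2 * enorm (u - y) * enorm (v - u) <= enorm (v - y) ^+ 2.
Proof.
have -> : v - y = (u - y) + (v - u) by rewrite [RHS]addrC subrKA.
move: (u - y) (v - u) => a b; rewrite !sqr_enorm !dotvE.
have := cauchy_schwarz a b; rewrite ler_norml (dotvC b a) => /andP[h _].
have := dotvv_ge0 b; lra.
Qed.

Lemma quadratic_lsc (c : R) y u e : 0 <= c -> 0 < e ->
  nbhs u [set v | c * enorm (u - y) ^+ 2 - e < c * enorm (v - y) ^+ 2].
Proof.
move=> c0 e0; apply/nbhs_enormP.
set M := c * (2 * enorm (u - y)).
have M0 : 0 <= M by rewrite !mulr_ge0 ?enorm_ge0.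
exists (e / (M + 1)); first by rewrite divr_gt0// ltr_wpDl.
move=> v; rewrite ltr_pdivlMr ?ltr_wpDl// => uv.
have := ler_wpM2l c0 (sqr_enormB_ge u v y).
rewrite mulrBr [X in _ - X]mulrA -/M => h.
by have := enorm_ge0 (v - u); rewrite /=; nra.
Qed.

(** The negative curvature allowed to [f] is beaten by the proximal term, so the objective is
    coercive and can be minimised over a closed ball. *)
Lemma argmin_prox_nonempty f (eta k0 k1 k2 : R) y :
  proper_fun f -> lower_semicontinuous f -> 0 < eta -> 0 <= k1 ->
  k2 < 1 / (2 * eta) ->
  (forall u, ((k0 - k1 * enorm (u - y) - k2 * enorm (u - y) ^+ 2)%:E <= f u)%E) ->
  argmin (fun u => f u + (1 / (2 * eta) * enorm (u - y) ^+ 2)%:E)%E !=set0.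
Proof.
move=> [fNy [u0 du0]] lf eta0 k10 k2lt lower.
set c := 1 / (2 * eta); have c0 : 0 <= c by rewrite divr_ge0// mulr_ge0// ltW.
set h := fun u => _.
have hu0 : f u0 \is a fin_num by rewrite fin_numE fNy lt_eqF.
pose a0 := fine (f u0) + c * enorm (u0 - y) ^+ 2 - k0.
pose dk := c - k2; have dk0 : 0 < dk by rewrite subr_gt0.
pose M := Num.max (enorm (u0 - y)) ((k1 + `|a0|) / dk + 1).
have Mu0 : enorm (u0 - y) <= M by rewrite le_max lexx.
have M1 : (k1 + `|a0|) / dk + 1 <= M by rewrite le_max lexx orbT.
apply: (@lsc_argmin _ [set u | enorm u <= M + enorm y] u0) => //.
- by apply: lsc_add_fin => // u e e0; exact: quadratic_lsc.
- by move=> u; rewrite /h; case: (f u) (fNy u).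
- exact: closed_ball_compact.
- by have := enorm_le_add u0 y; rewrite /=; lra.
move=> u /=/negP; rewrite -ltNge => uM.
have Mu : M < enorm (u - y) by have := enorm_le_add u y; lra.
have h1 : ((k0 - k1 * enorm (u - y) + dk * enorm (u - y) ^+ 2)%:E <= h u)%E.
  rewrite /h; case: (f u) (lower u) => [b||].
  - by rewrite -EFinD !lee_fin /dk; lra.
  - by move=> _; rewrite leey.
  - by rewrite leNgt ltNyr.
apply: le_trans h1; rewrite /h -(fineK hu0) -EFinD lee_fin -/c.
set t := enorm (u - y) in Mu *.
have h2 : (k1 + `|a0|) / dk + 1 < t by lra.
have h3 : k1 + `|a0| <= dk * t.
  by rewrite mulrC -ler_pdivrMr//; lra.
have h4 : 0 <= (k1 + `|a0|) / dk by apply: divr_ge0; [exact: addr_ge0|exact: ltW].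
have t1 : 1 <= t by lra.
have := ler_norm a0; have := normr_ge0 a0; rewrite /a0 in h3 *; nra.
Qed.

Definition subgradient f p v := forall w, (f p + (dotv v (w - p))%:E <= f w)%E.

(** Compare the minimiser with points of the segment towards [w], use convexity, divide by the step
    length [l] and let [l] tend to 0. *)
Lemma prox_subgradient f (eta : R) y p : proper_fun f -> convex_efun f -> 0 < eta ->
  argmin (fun u => f u + (1 / (2 * eta) * enorm (u - y) ^+ 2)%:E)%E p ->
  f p \is a fin_num /\ subgradient f p (eta^-1 *: (y - p)).
Proof.
move=> [fNy [u0 du0]] cf eta0 minp.
set c := 1 / (2 * eta); have c0 : 0 < c by rewrite divr_gt0// mulr_gt0.
have fp : f p \is a fin_num.
  have := minp u0; rewrite fin_numE fNy /=; have := fNy p; move: du0 (fNy u0).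
  rewrite /dom /=; case: (f p) => [?||] //; case: (f u0) => //.
split=> // w; case fwE : (f w) => [b||]; [|by rewrite leey|by move: (fNy w); rewrite fwE].
move: minp fp; case fpE : (f p) => [a||] // minp _.
rewrite -EFinD lee_fin dotvZl.
set D := dotv (p - y) (w - p); set N := enorm (w - p) ^+ 2.
have -> : dotv (y - p) (w - p) = - D by rewrite /D -opprB dotvNl.
have N0 : 0 <= N by rewrite exprn_ge0// enorm_ge0.
have etac : eta^-1 = 2 * c by rewrite /c; field; rewrite gt_eqF.
rewrite etac.
have step (l : R) : 0 < l <= 1 -> a - b - 2 * c * D <= l * (c * N).
  move=> /andP[l0 l1].
  have := cf w p l ltac:(by rewrite ltW); rewrite fwE fpE.
  have := minp (l *: w + (1 - l) *: p); have := fNy (l *: w + (1 - l) *: p).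
  rewrite fpE; case: (f (_ + _)) => [z||] //.
  rewrite -!EFinM -!EFinD !lee_fin -/c => _ h1 h2.
  have E : enorm (l *: w + (1 - l) *: p - y) ^+ 2 =
      enorm (p - y) ^+ 2 + 2 * l * D + l ^+ 2 * N.
    have -> : l *: w + (1 - l) *: p - y = (p - y) + l *: (w - p).
      by rewrite scalerBl scale1r scalerBr; apply/rowP => i; rewrite !mxE; ring.
    rewrite /N !sqr_enorm [in LHS]dotvDl [dotv (p - y) _]dotvDr.
    rewrite [dotv (l *: _) _]dotvDr !dotvZl !dotvZr (dotvC (w - p) (p - y)) -/D.
    ring.
  rewrite E in h1; rewrite -(ler_pM2l l0); lra.
have := N0; rewrite le_eqVlt => /predU1P[N0'|Npos].
  by have := step 1 ltac:(by rewrite ltr01 lexx); rewrite -N0'; lra.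
suff : a - b - 2 * c * D <= 0 by lra.
apply/ler_addgt0Pr => e e0; rewrite add0r.
have cN : 0 < c * N by rewrite mulr_gt0.
have := step (Num.min 1 (e / (c * N))).
rewrite lt_min ltr01 divr_gt0//= ge_min lexx => /(_ isT) h.
apply: (le_trans h); rewrite -ler_pdivlMr// ge_min lexx orbT//.
Qed.

Lemma subgradient_monotone f p1 p2 v1 v2 :
  f p1 \is a fin_num -> f p2 \is a fin_num ->
  subgradient f p1 v1 -> subgradient f p2 v2 -> 0 <= dotv (v1 - v2) (p1 - p2).
Proof.
move=> f1 f2 s1 s2; have := s1 p2; have := s2 p1.
rewrite -(fineK f1) -(fineK f2) -!EFinD !lee_fin -(opprB p1 p2) !dotvE; lra.
Qed.

(** Monotonicity of subgradients gives [enorm (p1 - p2) ^+ 2 <= dotv (y1 - y2) (p1 - p2)];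
    Cauchy-Schwarz finishes. *)
Lemma resolvent_nonexpansive f (eta : R) y1 y2 p1 p2 : 0 < eta ->
  f p1 \is a fin_num -> f p2 \is a fin_num ->
  subgradient f p1 (eta^-1 *: (y1 - p1)) -> subgradient f p2 (eta^-1 *: (y2 - p2)) ->
  enorm (p1 - p2) <= enorm (y1 - y2).
Proof.
move=> eta0 f1 f2 s1 s2; have := subgradient_monotone _ _ _ _ _ f1 f2 s1 s2.
rewrite -scalerBr dotvZl pmulr_rge0 ?invr_gt0//.
have -> : y1 - p1 - (y2 - p2) = (y1 - y2) - (p1 - p2).
  by apply/rowP => i; rewrite !mxE; ring.
rewrite dotvDl dotvNl -sqr_enorm => h.
have [->|p12] := eqVneq (enorm (p1 - p2)) 0; first exact: enorm_ge0.
have pp : 0 < enorm (p1 - p2) by rewrite lt_neqAle eq_sym p12 enorm_ge0.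
rewrite -(ler_pM2r pp); have := dotv_le (y1 - y2) (p1 - p2); lra.
Qed.

End Objective.

(** * Subgradients of [f + g] and of [H] obtained from quadratic minorants *)

Section Subdifferential.
Context {R : realType}.

(** A quadratic minorant bounds the difference quotient below by [- K * enorm (y - z)], which tends
    to 0. *)
Lemma frechet_subdiff_quadratic {m : nat} (h : 'rV[R]_m -> \bar R) z w (K : R) :
  0 <= K -> h z \is a fin_num ->
  (forall y, (h z + (dotv w (y - z) - K * enorm (y - z) ^+ 2)%:E <= h y)%E) ->
  frechet_subdiff h z w.
Proof.
move=> K0 hz lower; split; first by rewrite /dom /= -(fineK hz) ltry.
rewrite leeNr oppe0; apply/lee_addgt0Pr => e e0; rewrite add0e.
pose d := e / (K + 1).
have d0 : 0 < d by rewrite divr_gt0// ltr_wpDl.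
rewrite /limf_esup; set F := fun y => _.
have zV : z^' [set y | y != z /\ enorm (y - z) < d].
  by rewrite /dnbhs; apply/nbhs_enormP; exists d.
have FV : [set F V | V in z^'] (F [set y | y != z /\ enorm (y - z) < d]).
  by exists [set y | y != z /\ enorm (y - z) < d].
apply: (le_trans (ereal_inf_lbound FV)); rewrite {FV}/F.
apply: ge_ereal_sup => _ [y [yz yd] <-].
have N0 : 0 < enorm (y - z).
  rewrite lt_neqAle enorm_ge0 andbT eq_sym; apply: contra yz => /eqP/enorm_eq0/eqP.
  by rewrite subr_eq0.
move: (lower y); rewrite -(fineK hz).
case: (h y) => [b||]; last by rewrite -EFinD leNgt ltNyr.
  rewrite -EFinD !lee_fin => hb; rewrite lerNl.
  rewrite ler_pdivlMr// mulNr lerNl.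
  have : d * (K + 1) = e by rewrite /d divfK// gt_eqF// ltr_wpDl.
  have : K * enorm (y - z) ^+ 2 <= K * d * enorm (y - z).
    by rewrite expr2 mulrA ler_wpM2r ?enorm_ge0// ler_wpM2l// ltW.
  nra.
by move=> _ /=; rewrite gt0_mulye ?lte_fin ?invr_gt0 ?leNye.
Qed.

Lemma frechet_subset_limiting {m : nat} (h : 'rV[R]_m -> \bar R) z w :
  frechet_subdiff h z w -> limiting_subdiff h z w.
Proof.
move=> hw; have [dz _] := hw; split=> //.
exists (fun=> z), (fun=> w); split=> //; exact: cvg_cst.
Qed.

Context {n : nat}.
Variables (f : 'rV[R]_n -> \bar R) (g : 'rV[R]_n -> R) (G : 'rV[R]_n -> 'rV[R]_n) (beta eta : R).
Hypothesis beta_ge0 : 0 <= beta.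
Hypothesis g_quad : forall u v,
  `|g v - g u - dotv (G u) (v - u)| <= beta * enorm (v - u) ^+ 2.
Hypothesis eta_gt0 : 0 < eta.

Lemma dotv_row_mx (u v u' v' : 'rV[R]_n) :
  dotv (row_mx u v) (row_mx u' v') = dotv u u' + dotv v v'.
Proof.
by rewrite /dotv big_split_ord; congr (_ + _); apply: eq_bigr => i _;
  rewrite ?row_mxEl ?row_mxEr.
Qed.

Lemma HfunE u v : Hfun eta f g (row_mx u v) =
  (f u + (g u)%:E + (1 / (2 * eta) * enorm (u - v) ^+ 2)%:E)%E.
Proof. by rewrite /Hfun row_mxKl row_mxKr. Qed.

Lemma gradient_lower_bound u v :
  g u + dotv (G u) (v - u) - beta * enorm (v - u) ^+ 2 <= g v.
Proof.
have := g_quad u v.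
by rewrite ler_norml => /andP[]; lra.
Qed.

Lemma gradient_upper_bound u v :
  g v <= g u + dotv (G u) (v - u) + beta * enorm (v - u) ^+ 2.
Proof.
have := g_quad u v.
by rewrite ler_norml => /andP[_]; lra.
Qed.

Lemma objective_frechet_subdiff p xi : f p \is a fin_num -> subgradient f p xi ->
  frechet_subdiff (objective f g) p (xi + G p).
Proof.
move=> fp sub; apply: (@frechet_subdiff_quadratic _ _ _ _ beta) => //.
  by rewrite /objective -(fineK fp) -EFinD.
move=> y; rewrite /objective.
have := sub y; have := gradient_lower_bound p y; rewrite -(fineK fp) dotvDl.
case: (f y) => [b||] hg; rewrite -!EFinD; last by rewrite leNgt ltNyr.
  rewrite !lee_fin; lra.
by move=> _; rewrite addye// leey.
Qed.

(** No sum rule is invoked: the minorants of [f], of [g] and of the convex quadratic coupling are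
    added, leaving a quadratic defect with constant [beta]. *)
Lemma Hfun_frechet_subdiff p v xi : f p \is a fin_num -> subgradient f p xi ->
  frechet_subdiff (Hfun eta f g) (row_mx p v)
    (row_mx (xi + G p + eta^-1 *: (p - v)) (eta^-1 *: (v - p))).
Proof.
move=> fp sub; apply: (@frechet_subdiff_quadratic _ _ _ _ beta) => //.
  by rewrite HfunE -(fineK fp) -!EFinD.
move=> y; rewrite -[y]hsubmxK; set a := lsubmx y; set b := rsubmx y.
rewrite !HfunE opp_row_mx add_row_mx sqr_enorm !dotv_row_mx -!sqr_enorm.
have := sub a; have := gradient_lower_bound p a; rewrite -(fineK fp).
case: (f a) => [fa||] hg; rewrite -!EFinD; last by rewrite leNgt ltNyr.
  rewrite !lee_fin => hf.
  have -> : a - b = (p - v) + ((a - p) - (b - v)).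
    by apply/rowP => i; rewrite !mxE; ring.
  have -> : v - p = - (p - v) by rewrite opprB.
  move: (a - p) (b - v) (p - v) hf hg => A B C hf hg.
  have c0 : 0 < 1 / (2 * eta) by rewrite divr_gt0// mulr_gt0.
  have -> : eta^-1 = 2 * (1 / (2 * eta)) by field; rewrite gt_eqF.
  move: (1 / (2 * eta)) c0 => c c0.
  have := mulr_ge0 (ltW c0) (dotvv_ge0 (A - B)).
  have := mulr_ge0 beta_ge0 (dotvv_ge0 B).
  move: hf hg; rewrite !sqr_enorm !dotvE (dotvC A C) (dotvC B C) (dotvC B A).
  rewrite dotv_row_mx; lra.
by move=> _; rewrite -addeA addye ?leey.
Qed.

End Subdifferential.

(** * The forward-backward system *)

Section Dynamics.
Context {R : realType} {n : nat}.
Variables (f : 'rV[R]_n -> \bar R) (g : 'rV[R]_n -> R).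
Variables (G : 'rV[R]_n -> 'rV[R]_n) (beta eta lb M : R).
Variables (x q : R -> 'rV[R]_n).
(* [q] is the derivative of [x], and [G] stands for [grad g], of which only the
   two inequalities below matter. *)
Hypothesis f_proper : proper_fun f.
Hypothesis f_convex : convex_efun f.
Hypothesis f_lsc : lower_semicontinuous f.
Hypothesis beta_ge0 : 0 <= beta.
Hypothesis g_lip : forall u v,
  enorm (G u - G v) <= beta * enorm (u - v).
Hypothesis g_quad : forall u v,
  `|g v - g u - dotv (G u) (v - u)| <= beta * enorm (v - u) ^+ 2.
Hypothesis fg_ge : forall u, (lb%:E <= objective f g u)%E.
Hypothesis eta_gt0 : 0 < eta.
Hypothesis eta_beta : eta * beta * (3 + eta * beta) < 1.
Hypothesis x_deriv : derivative_on_halfline x q.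
Hypothesis x_prox : forall t, 0 <= t ->
  q t + x t = prox eta f (x t - eta *: G (x t)).
Hypothesis x_bounded : forall t, 0 <= t -> enorm (x t) <= M.

(* The value of [Hfun] at [(x t + x' t, x t)]. *)
Definition energy t := fine (f (x t + q t)) + g (x t + q t)
  + 1 / (2 * eta) * enorm (q t) ^+ 2.

(** The dissipation constant: [eta^-1] from the proximal step, minus the cost of comparing the
    gradients at [x + q] and at [x]. *)
Definition decay := eta^-1 - beta * (1 + eta * beta).

Let etabeta_ge0 : 0 <= eta * beta. Proof. by rewrite mulr_ge0 // ltW. Qed.

Let etabeta_lt : 3 * (eta * beta) < 1.
Proof. by move: eta_beta etabeta_ge0; move: (eta * beta) => z; nra. Qed.

Lemma decay_gt0 : 0 < decay.
Proof.
rewrite /decay -(pmulr_rgt0 _ eta_gt0) mulrBr divff ?gt_eqF//.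
by have := etabeta_ge0; have := eta_beta; rewrite mulrA; move: (eta * beta) => z; lra.
Qed.

Lemma prox_step t : 0 <= t ->
  f (x t + q t) \is a fin_num /\
  subgradient f (x t + q t) (- (eta^-1 *: q t) - G (x t)).
Proof.
move=> t0; set y := x t - eta *: G (x t).
have -> : - (eta^-1 *: q t) - G (x t) = eta^-1 *: (y - (x t + q t)).
  rewrite /y; apply/rowP => i; rewrite !mxE.
  by field; rewrite gt_eqF.
apply: prox_subgradient => //; rewrite addrC x_prox//.
(* A lower bound on [f] comes from [f + g >= lb] and the quadratic upper bound of [g] at [y]; its
   curvature is admissible because [2 * eta * beta < 1]. *)
apply: getPex; apply: (@argmin_prox_nonempty _ _ f eta (lb - g y) (enorm (G y)) beta) => //.
- exact: enorm_ge0.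
- rewrite ltr_pdivlMr ?mulr_gt0//; have := etabeta_lt; have := etabeta_ge0; lra.
- move=> u; have := fg_ge u; rewrite /objective.
  have := gradient_upper_bound g G beta g_quad y u.
  have := dotv_le (G y) (u - y).
  case: (f u) => [a||] h1 h2; last by rewrite leNgt ltNyr.
    rewrite -EFinD !lee_fin; lra.
  by move=> _; rewrite leey.
Qed.

(** The forward step has Lipschitz constant [1 + eta * beta], and the resolvent is nonexpansive. *)
Lemma prox_step_lipschitz s t : 0 <= s -> 0 <= t ->
  enorm (x s + q s - (x t + q t)) <= (1 + eta * beta) * enorm (x s - x t).
Proof.
move=> s0 t0; have [fs ss] := prox_step s s0; have [ft st] := prox_step t t0.
have E u : - (eta^-1 *: q u) - G (x u) =
    eta^-1 *: (x u - eta *: G (x u) - (x u + q u)).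
  by apply/rowP => i; rewrite !mxE; field; rewrite gt_eqF.
rewrite E in ss; rewrite E in st.
apply: le_trans (resolvent_nonexpansive _ _ _ _ _ _ eta_gt0 fs ft ss st) _.
have -> : x s - eta *: G (x s) - (x t - eta *: G (x t)) =
    (x s - x t) - eta *: (G (x s) - G (x t)).
  move: (G (x s)) (G (x t)) => G1 G2.
  by apply/rowP => i; rewrite !mxE; ring.
apply: (le_trans (enormB_le _ _)); rewrite enormZ gtr0_norm//.
have := ler_wpM2l (ltW eta_gt0) (g_lip (x s) (x t)); lra.
Qed.

Lemma energy_diff_le s t : 0 <= s -> 0 <= t ->
  energy s - energy t <= - eta^-1 * dotv (q s) (x s - x t)
    + beta * (1 + eta * beta) * (enorm (q s) * enorm (x s - x t))
    + beta * (1 + eta * beta) ^+ 2 * enorm (x s - x t) ^+ 2.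
Proof.
move=> s0 t0; have [fs ss] := prox_step s s0; have [ft _] := prox_step t t0.
rewrite /energy; set P := x s + q s - (x t + q t).
have hf : fine (f (x s + q s)) - fine (f (x t + q t)) <=
    dotv (- (eta^-1 *: q s) - G (x s)) P.
  have := ss (x t + q t); rewrite -(fineK fs) -(fineK ft) -EFinD lee_fin.
  by rewrite -/P -[x t + q t - _]opprB -/P dotvNr; lra.
have PX := prox_step_lipschitz s t s0 t0; rewrite -/P in PX.
have hg := gradient_lower_bound g G beta g_quad (x s + q s) (x t + q t).
rewrite -[x t + q t - _]opprB -/P dotvNr enormN in hg.
(* The subgradient of [f] carries [G (x s)] while the bound on [g] carries [G (x s + q s)]; this is
   the mismatch. *)
have hgg : dotv (G (x s + q s) - G (x s)) P <=
    beta * (1 + eta * beta) * (enorm (q s) * enorm (x s - x t)).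
  apply: (le_trans (dotv_le _ _)).
  have h1 := g_lip (x s + q s) (x s).
  have E : x s + q s - x s = q s by rewrite addrAC subrr add0r.
  rewrite E in h1.
  apply: (le_trans (ler_wpM2r (enorm_ge0 _) h1)).
  have h2 : 0 <= beta * enorm (q s) by rewrite mulr_ge0 ?enorm_ge0.
  by have := ler_wpM2l h2 PX; lra.
have hPP : beta * enorm P ^+ 2 <= beta * (1 + eta * beta) ^+ 2 * enorm (x s - x t) ^+ 2.
  rewrite -mulrA; apply: ler_wpM2l => //; rewrite -exprMn.
  by rewrite ler_pXn2r// nnegrE ?(le_trans (enorm_ge0 _) PX) ?enorm_ge0.
have -> : 1 / (2 * eta) = eta^-1 / 2 by field; rewrite gt_eqF.
have qq : eta^-1 / 2 * enorm (q s) ^+ 2 - eta^-1 / 2 * enorm (q t) ^+ 2 <=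
    eta^-1 * dotv (q s) (q s - q t).
  have : 0 <= eta^-1 / 2 by rewrite divr_ge0 ?invr_ge0 ?ltW.
  move=> /(fun h => mulr_ge0 h (dotvv_ge0 (q s - q t))).
  by rewrite !sqr_enorm !dotvE (dotvC (q t) (q s)); lra.
(* The part along [q s - q t] cancels against [qq], so no derivative of [q] is needed. *)
have PE : dotv (q s) P = dotv (q s) (x s - x t) + dotv (q s) (q s - q t).
  by rewrite -dotvDr /P; congr dotv; apply/rowP => i; rewrite !mxE; ring.
rewrite dotvDl in hgg.
rewrite dotvDl !dotvNl dotvZl PE in hf.
rewrite dotvNl in hgg.
lra.
Qed.

Lemma x_expansion t e : 0 <= t -> 0 < e -> exists2 d, 0 < d &
  forall s, 0 <= s -> `|s - t| < d -> enorm (x s - x t - (s - t) *: q t) <= e * `|s - t|.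
Proof.
move=> t0 e0; have /cvg_enormP/(_ e e0) := x_deriv t t0.
rewrite near_withinE => /nbhs_ballP[d /= d0 hd]; exists d => // s s0 std.
have [->|st] := eqVneq s t; first by rewrite !subrr scale0r subr0 enorm0 normr0 mulr0.
have := hd s; rewrite /ball /= distrC => /(_ std st s0) h.
have st0 : s - t != 0 by rewrite subr_eq0.
have -> : x s - x t - (s - t) *: q t =
    (s - t) *: ((s - t)^-1 *: (x s - x t) - q t).
  by rewrite scalerBr scalerA mulfV// scale1r.
by rewrite enormZ mulrC ler_wpM2r// ltW.
Qed.

Lemma x_step_le t e : 0 <= t -> 0 < e -> exists2 d, 0 < d &
  forall s, 0 <= s -> `|s - t| < d ->
    enorm (x s - x t) <= (enorm (q t) + e) * `|s - t|.
Proof.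
move=> t0 e0; have [d d0 hd] := x_expansion t e t0 e0; exists d => // s s0 std.
have := hd s s0 std; have := enorm_le_add (x s - x t) ((s - t) *: q t).
by rewrite enormZ; lra.
Qed.

Lemma x_right_step t e : 0 <= t -> 0 < e -> exists2 d, 0 < d &
  forall s, t < s < t + d -> enorm (x s - x t) <= (enorm (q t) + e) * (s - t).
Proof.
move=> t0 e0; have [d d0 hd] := x_step_le t e t0 e0; exists d => // s /andP[ts std].
have st0 : 0 <= s - t by lra.
by have := hd s; rewrite ger0_norm//; apply; lra.
Qed.

Lemma x_continuous t e : 0 <= t -> 0 < e -> exists2 d, 0 < d &
  forall s, 0 <= s -> `|s - t| < d -> enorm (x s - x t) <= e.
Proof.
move=> t0 e0; have [d d0 hd] := x_step_le t 1 t0 ltr01.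
have q1 : 0 < enorm (q t) + 1 by rewrite ltr_wpDl ?enorm_ge0.
exists (Num.min d (e / (enorm (q t) + 1))); first by rewrite lt_min d0 divr_gt0.
move=> s s0; rewrite lt_min => /andP[/(hd s s0) h1 h2].
apply: (le_trans h1); rewrite mulrC -ler_pdivlMr//; exact: ltW.
Qed.

(** A uniform bound on the velocity, from comparing the proximal points at times [t] and 0 with [x]
    bounded by [M]. *)
Definition speed := enorm (x 0 + q 0) + (1 + eta * beta) * (M + M) + M.

Lemma q_le_speed t : 0 <= t -> enorm (q t) <= speed.
Proof.
move=> t0; have h := prox_step_lipschitz t 0 t0 (lexx 0).
have h1 := enorm_le_add (x t + q t) (x 0 + q 0).
have h2 := enormB_le (x t) (x 0).
have h3 := enormB_le (x t + q t) (x t).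
rewrite addrAC subrr add0r in h3.
have h4 := x_bounded t t0; have h5 := x_bounded 0 (lexx 0).
have : (1 + eta * beta) * enorm (x t - x 0) <= (1 + eta * beta) * (M + M).
  by rewrite ler_wpM2l ?addr_ge0 ?ler01 ?etabeta_ge0//; lra.
rewrite /speed; lra.
Qed.

Lemma speed_ge0 : 0 <= speed.
Proof. exact: le_trans (enorm_ge0 _) (q_le_speed 0 (lexx 0)). Qed.

(** A mean value inequality: the distance from [x s] minus [speed * t] has nonpositive Dini
    derivative. *)
Lemma x_lipschitz s t : 0 <= s -> 0 <= t ->
  enorm (x s - x t) <= speed * `|s - t|.
Proof.
wlog st : s t / s <= t => [wlg s0 t0|s0 t0].
  have [st|/ltW ts] := leP s t; first exact: wlg.
  by rewrite enormBC distrC wlg.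
rewrite enormBC distrC ger0_norm ?subr_ge0//.
suff : enorm (x t - x s) + - speed * t <= enorm (x s - x s) + - speed * s.
  by rewrite subrr enorm0; lra.
apply: (@right_dini_nonincreasing _ (fun t => enorm (x t - x s) + - speed * t) s t 1) => //.
- move=> u e /andP[su ut] e0; have u0 : 0 <= u by lra.
  have [d d0 hd] := x_continuous u e u0 e0; exists d => // v sv /andP[uv vu].
  have := hd v ltac:(lra) ltac:(by rewrite distrC ger0_norm; lra).
  have := enorm_dist (x v) (x u) (x s); rewrite (enormBC (x u) (x v)).
  have := ler_wpM2l speed_ge0 (ltW vu); lra.
move=> u /andP[su ut] _; have u0 : 0 <= u by lra.
apply: (@right_dini_le_weaken _ _ _ (enorm (q u) + - speed)).
  by have := q_le_speed u u0; lra.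
apply: right_dini_leD; last exact: right_dini_le_linear.
by apply: dist_right_dini u0 => t' e; exact: x_right_step.
Qed.

(** The velocity is the proximal point minus [x], and both are Lipschitz in time. *)
Lemma q_lipschitz s t : 0 <= s -> 0 <= t ->
  enorm (q s - q t) <= (2 + eta * beta) * speed * `|s - t|.
Proof.
move=> s0 t0; have h := prox_step_lipschitz s t s0 t0.
have -> : q s - q t = (x s + q s - (x t + q t)) - (x s - x t).
  by apply/rowP => i; rewrite !mxE; ring.
apply: (le_trans (enormB_le _ _)).
have h2 := x_lipschitz s t s0 t0.
have e0 : 0 <= 2 + eta * beta by have := etabeta_ge0; lra.
by have := ler_wpM2l e0 h2; lra.
Qed.

Lemma energy_right_dini t : 0 <= t ->
  right_dini_le energy t (- (decay * enorm (q t) ^+ 2)).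
Proof.
move=> t0 e e0.
set Q := speed; set L := (2 + eta * beta) * speed.
have Q0 : 0 <= Q := speed_ge0.
have e2 : 0 <= 2 + eta * beta by have := etabeta_ge0; lra.
have L0 : 0 <= L by rewrite mulr_ge0.
have ieta : 0 <= eta^-1 by rewrite invr_ge0 ltW.
pose k := beta * (1 + eta * beta); pose k' := beta * (1 + eta * beta) ^+ 2.
have k0 : 0 <= k by rewrite mulr_ge0// addr_ge0.
have k'0 : 0 <= k' by rewrite mulr_ge0// exprn_ge0// addr_ge0.
(* [S1] collects the coefficients of the errors of order [e1 * tau] and [S2] those of order
   [tau ^+ 2]; each group is allotted half of [e]. *)
pose S1 := (eta^-1 + k) * Q; pose S2 := (eta^-1 + k) * (L * Q) + k' * Q ^+ 2.
have S10 : 0 <= S1 by rewrite mulr_ge0// addr_ge0.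
have iek : 0 <= eta^-1 + k by exact: addr_ge0.
have S20 : 0 <= S2.
  apply: addr_ge0; first exact: mulr_ge0 iek (mulr_ge0 L0 Q0).
  exact: mulr_ge0 k'0 (exprn_ge0 _ Q0).
pose e1 := e / (2 * (S1 + 1)); pose d2 := e / (2 * (S2 + 1)).
have e10 : 0 < e1 by rewrite divr_gt0// mulr_gt0// ltr_wpDl.
have d20 : 0 < d2 by rewrite divr_gt0// mulr_gt0// ltr_wpDl.
have e1E : S1 * e1 <= e / 2.
  by rewrite /e1 mulrA ler_pdivrMr ?mulr_gt0 ?ltr_wpDl//; nra.
have d2E : S2 * d2 <= e / 2.
  by rewrite /d2 mulrA ler_pdivrMr ?mulr_gt0 ?ltr_wpDl//; nra.
have [d1 d10 hd1] := x_expansion t e1 t0 e10.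
exists (Num.min d1 d2); first by rewrite lt_min d10.
move=> s /andP[ts]; rewrite -ltrBlDl lt_min => /andP[sd1 sd2].
have s0 : 0 <= s by lra.
set tau := s - t in sd1 sd2 *; have tau0 : 0 < tau by rewrite subr_gt0.
have := hd1 s s0; rewrite -/tau gtr0_norm// => /(_ sd1) hE.
have := energy_diff_le s t s0 t0; rewrite -/k -/k'.
set A := enorm (q t).
have A0 : 0 <= A := enorm_ge0 _.
have AQ : A <= Q := q_le_speed t t0.
have qsQ : enorm (q s) <= Q := q_le_speed s s0.
have hD : enorm (q s - q t) <= L * tau.
  by have := q_lipschitz s t s0 t0; rewrite -/tau gtr0_norm.
have hX : enorm (x s - x t) <= Q * tau.
  by have := x_lipschitz s t s0 t0; rewrite -/tau gtr0_norm.
have hX2 : enorm (x s - x t) <= (A + e1) * tau.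
  have := enorm_le_add (x s - x t) (tau *: q t); rewrite enormZ gtr0_norm// -/A; lra.
have hqs : enorm (q s) <= A + L * tau.
  by have := enorm_le_add (q s) (q t); rewrite -/A; lra.
have XE : dotv (q s) (x s - x t) = tau * A ^+ 2 + tau * dotv (q s - q t) (q t)
    + dotv (q s) (x s - x t - tau *: q t).
  rewrite sqr_enorm [dotv (q s) (_ - _ *: _)]dotvDr dotvNr dotvZr.
  by rewrite [dotv (q s - q t) _]dotvDl dotvNl; ring.
have b1 : - dotv (q s - q t) (q t) <= L * tau * Q.
  rewrite -dotvNl; apply: (le_trans (dotv_le _ _)); rewrite enormN.
  by apply: ler_pM; rewrite ?enorm_ge0.
have b2 : - dotv (q s) (x s - x t - tau *: q t) <= Q * (e1 * tau).
  rewrite -dotvNl; apply: (le_trans (dotv_le _ _)); rewrite enormN.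
  by apply: ler_pM; rewrite ?enorm_ge0.
have b3 : enorm (q s) * enorm (x s - x t) <= (A ^+ 2 + Q * e1 + L * Q * tau) * tau.
  have h1 : enorm (q s) * enorm (x s - x t) <= (A + L * tau) * enorm (x s - x t).
    by rewrite ler_wpM2r ?enorm_ge0.
  have h2 := ler_wpM2l A0 hX2.
  have h3 := ler_wpM2l (mulr_ge0 L0 (ltW tau0)) hX.
  have h4 := ler_wpM2r (ltW (mulr_gt0 e10 tau0)) AQ.
  lra.
have b4 : enorm (x s - x t) ^+ 2 <= (Q * tau) ^+ 2.
  by rewrite ler_pXn2r ?nnegrE ?enorm_ge0// mulr_ge0// ltW.
have c1 := ler_wpM2l ieta (ler_wpM2l (ltW tau0) b1).
have c2 := ler_wpM2l ieta b2.
have c3 := ler_wpM2l k0 b3.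
have c4 := ler_wpM2l k'0 b4.
have c5 := ler_wpM2r (ltW tau0) e1E.
have c6 := ler_wpM2r (ltW tau0) d2E.
have c7 := ler_wpM2l S20 (ler_wpM2r (ltW tau0) (ltW sd2)).
have -> : decay = eta^-1 - k by [].
rewrite XE; move: c5 c6 c7; rewrite /S1 /S2.
lra.
Qed.

(** Besides the Dini bound this needs lower semicontinuity from the left, which is [energy_diff_le]
    with the later time as first argument. *)
Lemma energy_nonincreasing s t : 0 <= s -> s <= t -> energy t <= energy s.
Proof.
move=> s0 st; apply: (@right_dini_nonincreasing _ energy s t 1) => //.
- move=> u e /andP[su ut] e0; have u0 : 0 <= u by lra.
  set Q := speed; have Q0 : 0 <= Q := speed_ge0.
  pose k := beta * (1 + eta * beta); pose k' := beta * (1 + eta * beta) ^+ 2.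
  have k0 : 0 <= k by rewrite mulr_ge0// addr_ge0.
  have k'0 : 0 <= k' by rewrite mulr_ge0// exprn_ge0// addr_ge0.
  have ieta : 0 <= eta^-1 by rewrite invr_ge0 ltW.
  pose S := (eta^-1 + k) * Q + k'.
  have S0 : 0 <= S by rewrite addr_ge0// mulr_ge0// addr_ge0.
  pose e1 := Num.min 1 (e / (S + 1)).
  have S10 : 0 < S + 1 by lra.
  have e10 : 0 < e1 by rewrite lt_min ltr01 divr_gt0.
  have [d d0 hd] := x_continuous u e1 u0 e10.
  exists d => // v sv /andP[uv vu]; have v0 : 0 <= v by lra.
  have := hd v v0 ltac:(by rewrite distrC ger0_norm; lra).
  rewrite enormBC le_min => /andP[h1]; rewrite ler_pdivlMr// => h2.
  have := energy_diff_le u v u0 v0; rewrite -/k -/k'.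
  have := dotv_le (- q u) (x u - x v); rewrite dotvNl enormN.
  set X := enorm (x u - x v) in h1 h2 *; have X0 : 0 <= X := enorm_ge0 _.
  have c1 : enorm (q u) * X <= Q * X by rewrite ler_wpM2r//; exact: q_le_speed.
  have c2 : X ^+ 2 <= X by rewrite expr2 ler_piMl.
  move=> c3; have c4 := ler_wpM2l ieta (le_trans c3 c1).
  have c5 := ler_wpM2l k0 c1; have c6 := ler_wpM2l k'0 c2.
  move: h2; rewrite /S; lra.
move=> u /andP[su ut] _; have u0 : 0 <= u by lra.
apply: right_dini_le_weaken (energy_right_dini u u0).
by rewrite oppr_le0 mulr_ge0 ?exprn_ge0 ?enorm_ge0// ltW// decay_gt0.
Qed.

Lemma energy_ge_lb t : 0 <= t -> lb <= energy t.
Proof.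
move=> t0; have [ft _] := prox_step t t0; have := fg_ge (x t + q t).
rewrite /objective -(fineK ft) -EFinD lee_fin => h.
apply: (le_trans h); rewrite /energy lerDl mulr_ge0 ?exprn_ge0 ?enorm_ge0//.
by rewrite divr_ge0 ?mulr_ge0// ltW.
Qed.

(** The limit of the nonincreasing energy; [energy_infE] identifies it at a cluster point. *)
Definition energy_inf := inf (energy @` [set t | 0 <= t]).

Let has_inf_energy : has_inf (energy @` [set t | 0 <= t]).
Proof.
split; first by exists (energy 0), 0 => //=.
by exists lb => _ [t /= t0 <-]; exact: energy_ge_lb.
Qed.

Definition gap t := energy t - energy_inf.

Lemma gap_ge0 t : 0 <= t -> 0 <= gap t.
Proof.
move=> t0; rewrite subr_ge0; apply: ge_inf; first exact: has_inf_energy.2.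
by exists t.
Qed.

Lemma gap_nonincreasing s t : 0 <= s -> s <= t -> gap t <= gap s.
Proof. by move=> s0 st; rewrite lerD2r energy_nonincreasing. Qed.

Lemma gap_right_dini t : 0 <= t ->
  right_dini_le gap t (- (decay * enorm (q t) ^+ 2)).
Proof.
move=> t0 e e0; have [d d0 hd] := energy_right_dini t t0 e e0.
by exists d => // s std; rewrite /gap opprB addrA subrK; exact: hd.
Qed.

Lemma gap_small e : 0 < e -> exists2 T, 0 <= T & forall t, T <= t -> gap t < e.
Proof.
move=> e0; have [_ [T /= T0 <-] hT] := inf_adherent e0 has_inf_energy.
exists T => // t Tt; apply: le_lt_trans (gap_nonincreasing T t T0 Tt) _.
by rewrite ltrBlDl.
Qed.

Lemma velocity_small e : 0 < e ->
  exists2 T, 0 <= T & forall t, T <= t -> enorm (q t) <= e.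
Proof.
have L0 : 0 <= (2 + eta * beta) * speed.
  by rewrite mulr_ge0 ?speed_ge0// addr_ge0 ?etabeta_ge0.
apply: (velocity_cvg0 q gap decay decay_gt0 gap_ge0 gap_nonincreasing gap_right_dini
  _ e L0 q_lipschitz) => e' e'0.
by have [T T0 hT] := gap_small e' e'0; exists T => //; exact: hT.
Qed.

(** Compactness gives the point; since the velocity tends to 0, both smallness conditions hold at a
    common late time. *)
Lemma trajectory_cluster : exists xbar, forall e T, 0 < e ->
  exists t, [/\ 0 <= t, T <= t, enorm (x t - xbar) < e & enorm (q t) < e].
Proof.
have [|xbar [_ clx]] := closed_ball_compact M (x @ +oo) _.
  by exists 0; split=> // t t0 /=; exact: x_bounded (ltW t0).
exists xbar => e T e0.
have [Tq Tq0 hq] := velocity_small (e / 2) ltac:(by rewrite divr_gt0).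
pose S := Num.max (Num.max T Tq) 0.
have [||_ [[t /= St <-] xt]] := clx (x @` [set t | S < t]) [set v | enorm (v - xbar) < e].
- by exists S; split; [exact: num_real|move=> t /= St; exists t].
- by apply/nbhs_enormP; exists e.
move: (ltW St); rewrite !ge_max => /andP[/andP[Tt Tqt] t0].
exists t; split=> //; have := hq t Tqt; lra.
Qed.

(** * Criticality of a cluster point, and convergence of the trajectory to it *)

Section ClusterPoint.
Variable xbar : 'rV[R]_n.
Hypothesis xbar_cluster : forall e T, 0 < e ->
  exists t, [/\ 0 <= t, T <= t, enorm (x t - xbar) < e & enorm (q t) < e].

(** The subgradient inequality at [x t + q t] passes to the limit along times where [x t] is near
    [xbar] and [q t] near 0; lower semicontinuity handles the value of [f]. *)
Lemma cluster_subgradient :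
  f xbar \is a fin_num /\ subgradient f xbar (- G xbar).
Proof.
have key w b : f w = b%:E -> (f xbar <= (b + dotv (G xbar) (w - xbar))%:E)%E.
  move=> fw; rewrite leNgt; apply/negP => lt_f.
  set B := b + _ in lt_f.
  have [d d0 ltd] : exists2 d : R, 0 < d & ((B + d)%:E < f xbar)%E.
    case: (f xbar) lt_f => [r| |//]; last by exists 1 => //; rewrite ltry.
    rewrite lte_fin => Br; exists ((r - B) / 2); first by lra.
    by rewrite lte_fin; lra.
  have [V /nbhs_enormP[rho rho0 rhoV] VP] := f_lsc xbar _ ltd.
  set W := enorm (w - xbar).
  have W0 : 0 <= W := enorm_ge0 _.
  have ieta : 0 <= eta^-1 by rewrite invr_ge0 ltW.
  (* [C * e] bounds the errors from [q t], from replacing [G (x t)] by [G xbar], and from moving the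
     base point; [W + 2] bounds [enorm v] because [e <= 1]. *)
  pose C := (eta^-1 + beta) * (W + 2) + 2 * enorm (G xbar).
  have C0 : 0 <= C.
    by apply: addr_ge0; apply: mulr_ge0; rewrite ?enorm_ge0// addr_ge0.
  pose e := Num.min (rho / 3) (Num.min 1 (d / (C + 1))).
  have C10 : 0 < C + 1 by lra.
  have e0 : 0 < e by rewrite !lt_min ltr01 !divr_gt0.
  have : e <= e by []; rewrite {2}/e !le_min => /and3P[er e1].
  rewrite ler_pdivlMr// => eC.
  have [t [t0 _ xt qt]] := xbar_cluster e 0 e0.
  have [ft st] := prox_step t t0.
  have pE : x t + q t - xbar = (x t - xbar) + q t by rewrite addrAC.
  have pxb : enorm (x t + q t - xbar) <= 2 * e.
    by rewrite pE; have := enormD (x t - xbar) (q t); lra.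
  have := VP _ (rhoV (x t + q t) ltac:(lra)).
  have := st w; rewrite -(fineK ft) fw -EFinD lee_fin lte_fin => h1 h2.
  set v := w - (x t + q t) in h1.
  have vE : v = (w - xbar) - (x t + q t - xbar).
    by rewrite /v; apply/rowP => i; rewrite !mxE; ring.
  have vW : enorm v <= W + 2.
    rewrite vE; have := enormB_le (w - xbar) (x t + q t - xbar); rewrite -/W; lra.
  have v0 : 0 <= enorm v := enorm_ge0 _.
  have a1 : eta^-1 * dotv (q t) v <= eta^-1 * (e * (W + 2)).
    apply: ler_wpM2l => //; apply: (le_trans (dotv_le _ _)).
    by apply: ler_pM; rewrite ?enorm_ge0// ltW.
  have a2 : dotv (G (x t) - G xbar) v <= beta * e * (W + 2).
    apply: (le_trans (dotv_le _ _)); apply: ler_pM; rewrite ?enorm_ge0//.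
    by apply: (le_trans (g_lip _ _)); apply: ler_wpM2l => //; exact: ltW.
  have a3 : - dotv (G xbar) (x t + q t - xbar) <= enorm (G xbar) * (2 * e).
    rewrite -dotvNl; apply: (le_trans (dotv_le _ _)); rewrite enormN.
    by apply: ler_wpM2l => //; exact: enorm_ge0.
  have a4 : dotv (G xbar) v = dotv (G xbar) (w - xbar) - dotv (G xbar) (x t + q t - xbar).
    by rewrite vE dotvDr dotvNr.
  rewrite dotvDl !dotvNl dotvZl in h1.
  rewrite dotvDl dotvNl in a2.
  move: eC h2; rewrite /C /B; lra.
have fx : f xbar \is a fin_num.
  have [fNy [u0 du0]] := f_proper; rewrite fin_numE fNy /=.
  move: du0 (fNy u0) (key u0); rewrite /dom /=; case: (f u0) => // b _ _ /(_ b erefl) h.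
  by rewrite lt_eqF// (le_lt_trans h)// ltry.
split=> // w; have := key w; case fw : (f w) => [b||].
- move=> /(_ b erefl); rewrite -(fineK fx) -EFinD !lee_fin dotvNl; lra.
- by move=> _; rewrite leey.
- by have [/(_ w)] := f_proper; rewrite fw.
Qed.

(** Although [f] is only lower semicontinuous, subgradient inequalities at both [xbar] and
    [x t + q t] trap the difference of values, so the energy approaches that of [xbar] along the
    cluster times. *)
Lemma energy_infE : energy_inf = fine (f xbar) + g xbar.
Proof.
have [fx sx] := cluster_subgradient; set Fx := fine (f xbar) + g xbar.
have ieta : 0 <= eta^-1 by rewrite invr_ge0 ltW.
have c0 : 0 <= 1 / (2 * eta) by rewrite divr_ge0// mulr_ge0// ltW.
pose C := 2 * (eta^-1 + beta) + 4 * beta + 1 / (2 * eta).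
have C0 : 0 <= C by rewrite /C; have := beta_ge0; lra.
have near_xbar e T : 0 < e -> e <= 1 ->
    exists t, [/\ 0 <= t, T <= t & `|energy t - Fx| <= C * e].
  move=> e0 e1; have [t [t0 Tt xt qt]] := xbar_cluster e T e0.
  exists t; split=> //; have [ft st] := prox_step t t0.
  set D := x t + q t - xbar.
  have De : enorm D <= 2 * e.
    rewrite /D addrAC; have := enormD (x t - xbar) (q t); lra.
  have h1 := st xbar; rewrite -(fineK ft) -(fineK fx) -EFinD lee_fin in h1.
  have h2 := sx (x t + q t); rewrite -(fineK ft) -(fineK fx) -EFinD lee_fin in h2.
  rewrite -/D dotvNl in h2.
  rewrite -[xbar - _]opprB -/D dotvNr in h1.
  have := g_quad xbar (x t + q t); rewrite -/D ler_norml => /andP[h3 h4].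
  have DD : enorm D ^+ 2 <= 4 * e.
    have : enorm D ^+ 2 <= (2 * e) ^+ 2.
      by rewrite ler_pXn2r ?nnegrE ?enorm_ge0// mulr_ge0// ltW.
    have : e * e <= e by rewrite ler_piMl// ltW.
    lra.
  have qq : enorm (q t) ^+ 2 <= e.
    have : enorm (q t) ^+ 2 <= e ^+ 2.
      by rewrite ler_pXn2r ?nnegrE ?enorm_ge0 ?ltW.
    have : e * e <= e by rewrite ler_piMl// ltW.
    lra.
  have a1 : - dotv (q t) D <= 2 * e.
    rewrite -dotvNl; apply: (le_trans (dotv_le _ _)); rewrite enormN.
    have := ler_pM (enorm_ge0 _) (enorm_ge0 _) (ltW qt) De.
    have : e * e <= e by rewrite ler_piMl// ltW.
    lra.
  have a2 : dotv (G xbar - G (x t)) D <= beta * (2 * e).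
    apply: (le_trans (dotv_le _ _)).
    have g1 : enorm (G xbar - G (x t)) <= beta * e.
      apply: (le_trans (g_lip _ _)); apply: ler_wpM2l => //.
      by rewrite enormBC ltW.
    have := ler_pM (enorm_ge0 _) (enorm_ge0 _) g1 De.
    have : beta * (e * e) <= beta * e by apply: ler_wpM2l => //; rewrite ler_piMl// ltW.
    lra.
  have b1 := ler_wpM2l ieta a1.
  have b2 := ler_wpM2l beta_ge0 DD.
  have b3 := ler_wpM2l c0 qq.
  have b4 := mulr_ge0 c0 (sqr_ge0 (enorm (q t))).
  have b5 := mulr_ge0 ieta (ltW e0).
  have b6 := mulr_ge0 beta_ge0 (ltW e0).
  have b7 := mulr_ge0 c0 (ltW e0).
  rewrite dotvDl !dotvNl dotvZl in h1.
  rewrite dotvDl dotvNl in a2.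
  rewrite ler_norml /energy /Fx /C; apply/andP; split; lra.
have small e : 0 < e -> exists2 e', 0 < e' & (e' <= 1) && (C * e' <= e).
  move=> e0; exists (Num.min 1 (e / (C + 1))).
    by rewrite lt_min ltr01 divr_gt0// ltr_wpDl.
  have C10 : 0 < C + 1 by rewrite ltr_wpDl.
  rewrite ge_min lexx /=; apply: (@le_trans _ _ (C * (e / (C + 1)))).
    by apply: ler_wpM2l => //; rewrite ge_min lexx orbT.
  by rewrite mulrA ler_pdivrMr//; lra.
apply/le_anti/andP; split; apply/ler_addgt0Pr => e e0.
  have [e' e'0 /andP[e'1 Ce']] := small e e0.
  have [t [t0 _]] := near_xbar e' 0 e'0 e'1; rewrite ler_norml => /andP[_ h].
  have := gap_ge0 t t0; rewrite /gap; lra.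
have [e' e'0 /andP[e'1 Ce']] := small (e / 2) ltac:(by rewrite divr_gt0).
have [T T0 hT] := gap_small (e / 2) ltac:(by rewrite divr_gt0).
have [t [t0 Tt]] := near_xbar e' T e'0 e'1; rewrite ler_norml => /andP[h _].
have := hT t Tt; rewrite /gap; lra.
Qed.

Lemma Hfun_trajectory t : 0 <= t ->
  Hfun eta f g (row_mx (x t + q t) (x t)) = (energy t)%:E.
Proof.
move=> t0; have [ft _] := prox_step t t0.
by rewrite HfunE -(fineK ft) -!EFinD /energy (addrAC (x t)) subrr add0r.
Qed.

Lemma Hfun_cluster : Hfun eta f g (row_mx xbar xbar) = energy_inf%:E.
Proof.
have [fx _] := cluster_subgradient.
by rewrite HfunE -(fineK fx) -!EFinD energy_infE subrr enorm0 expr0n mulr0 addr0.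
Qed.

(** In the first block the coupling term cancels [- (eta^-1 *: q t)], leaving a difference of
    gradients; the second block is [- (eta^-1 *: q t)]. *)
Lemma Hfun_trajectory_subdiff t : 0 <= t -> exists2 w,
  limiting_subdiff (Hfun eta f g) (row_mx (x t + q t) (x t)) w &
  enorm w <= (beta + eta^-1) * enorm (q t).
Proof.
move=> t0; have [ft st] := prox_step t t0.
have := Hfun_frechet_subdiff f g G beta eta beta_ge0 g_quad eta_gt0 _ (x t) _ ft st.
move=> /frechet_subset_limiting; set w := (X in limiting_subdiff _ _ X) => hw; exists w => //.
have -> : w = row_mx (G (x t + q t) - G (x t)) 0 + row_mx 0 (- (eta^-1 *: q t)).
  rewrite add_row_mx addr0 add0r /w; congr row_mx.
    by apply/rowP => i; rewrite !mxE; ring.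
  by rewrite opprD addrA subrr add0r scalerN.
apply: (le_trans (enormD _ _)); rewrite mulrDl; apply: lerD.
  rewrite /enorm dotv_row_mx dotv0 addr0 -/(enorm _).
  have := g_lip (x t + q t) (x t).
  by rewrite [x t + q t - x t]addrAC subrr add0r.
rewrite /enorm dotv_row_mx dotv0 add0r -/(enorm _) enormN enormZ gtr0_norm ?invr_gt0//.
Qed.

Lemma crit_objective_cluster : crit (objective f g) xbar.
Proof.
have [fx sx] := cluster_subgradient.
have := objective_frechet_subdiff f g G beta beta_ge0 g_quad _ _ fx sx.
by rewrite addNr => /frechet_subset_limiting.
Qed.

Lemma crit_Hfun_cluster : crit (Hfun eta f g) (row_mx xbar xbar).
Proof.
have [fx sx] := cluster_subgradient.
have := Hfun_frechet_subdiff f g G beta eta beta_ge0 g_quad eta_gt0 _ xbar _ fx sx.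
by rewrite addNr subrr scaler0 addr0 row_mx0 => /frechet_subset_limiting.
Qed.

Lemma dist_trajectory_le t :
  enorm (row_mx (x t + q t) (x t) - row_mx xbar xbar) <=
  2 * enorm (x t - xbar) + enorm (q t).
Proof.
have -> : row_mx (x t + q t) (x t) - row_mx xbar xbar =
    row_mx (x t - xbar + q t) 0 + row_mx 0 (x t - xbar).
  by rewrite opp_row_mx !add_row_mx addr0 add0r addrAC.
apply: (le_trans (enormD _ _)).
rewrite {1 2}/enorm !dotv_row_mx !dotv0 addr0 add0r -!/(enorm _).
have := enormD (x t - xbar) (q t); lra.
Qed.

(** Trapping: from a late time with [x T] near [xbar] and a small gap, the length bound keeps the
    trajectory in the ball where the inequality is available. *)
Lemma local_lojasiewicz_cvg theta K rho mu :
  0 < theta < 1 -> 0 < K -> 0 < rho -> 0 < mu ->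
  (forall t, 0 <= t -> gap t < mu ->
     enorm (row_mx (x t + q t) (x t) - row_mx xbar xbar) < rho ->
     gap t `^ theta <= K * enorm (q t)) ->
  forall e, 0 < e -> exists T, forall t, T <= t -> enorm (x t - xbar) < e.
Proof.
move=> th01 K0 rho0 mu0 hloj e e0; have /andP[th0 th1] := th01.
pose r := Num.min rho e / 16.
have r0 : 0 < r by rewrite divr_gt0// lt_min rho0.
have : 16 * r <= Num.min rho e by rewrite /r mulrC divfK.
rewrite le_min => /andP[rrho re].
pose A := K / ((1 - theta) * decay).
have A0 : 0 < A by rewrite divr_gt0// mulr_gt0 ?decay_gt0// subr_gt0.
pose d := (r / A) `^ (1 - theta)^-1.
have rA0 : 0 < r / A by rewrite divr_gt0.
have d0 : 0 < d by rewrite powR_gt0.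
have [T1 T10 h1] := velocity_small r r0.
have [T2 T20 h2] := gap_small d d0.
have [T3 T30 h3] := gap_small mu mu0.
have [T [T0]] := xbar_cluster r (Num.max T1 (Num.max T2 T3)) r0.
rewrite !ge_max => /and3P[T1T T2T T3T] xT _.
have hA : A * gap T `^ (1 - theta) <= r.
  rewrite mulrC -ler_pdivlMr//.
  have -> : r / A = d `^ (1 - theta).
    by rewrite /d -powRrM mulVf ?powRr1 ?(ltW rA0)// subr_eq0 gt_eqF.
  apply: ge0_ler_powR; rewrite ?nnegrE ?(ltW d0) ?gap_ge0 ?subr_ge0 ?(ltW th1)//.
  exact/ltW/h2.
exists T => t Tt.
have : enorm (x t - x T) <= A * gap T `^ (1 - theta).
  apply: (length_le x q gap decay decay_gt0 x_right_step
    x_continuous gap_ge0 gap_nonincreasing gap_right_dini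
    theta K T r) => // s Ts; rewrite -/A => hs.
  have s0 : 0 <= s := le_trans T0 Ts.
  apply: hloj => //; first by apply: h3; exact: le_trans Ts.
  apply: (le_lt_trans (dist_trajectory_le s)).
  have := h1 s (le_trans T1T Ts).
  have := enorm_dist (x T) (x s) xbar; lra.
have := enorm_dist (x T) (x t) xbar; lra.
Qed.

Lemma KL_local C theta : 0 < C -> 0 < theta < 1 ->
  KL_property (Hfun eta f g) (row_mx xbar xbar) (fun s => C * s `^ (1 - theta)) ->
  exists rho mu K, [/\ 0 < rho, 0 < mu, 0 < K &
    forall t, 0 <= t -> gap t < mu ->
      enorm (row_mx (x t + q t) (x t) - row_mx xbar xbar) < rho ->
      gap t `^ theta <= K * enorm (q t)].
Proof.
move=> C0 /andP[th0 th1] [mu [U [mu0 /nbhs_enormP[rho rho0 rhoU] _ hKL]]].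
(* A real threshold replaces [mu], which may be infinite. *)
have [nu nu0 nuP] : exists2 nu : R, 0 < nu &
    forall s, s < nu -> ((energy_inf + s)%:E < energy_inf%:E + mu)%E.
  case: mu mu0 {hKL} => [r| |//].
    rewrite lte_fin => r0; exists r => // s sr.
    by rewrite -EFinD lte_fin ltrD2l.
  by move=> _; exists 1 => // s _; rewrite addey// ltry.
have L0 : 0 < beta + eta^-1 by rewrite ltr_wpDl ?invr_gt0.
have dth : 0 < 1 - theta by rewrite subr_gt0.
exists rho, nu, (C * (1 - theta) * (beta + eta^-1)); split=> //.
  by rewrite !mulr_gt0.
move=> t t0 gt_nu xt.
(* The KL inequality speaks only of values strictly above the critical one; at gap 0 the left side
   is 0. *)
have [gap0|gap_neq0] := eqVneq (gap t) 0.
  by rewrite gap0 powR0 ?gt_eqF// mulr_ge0 ?enorm_ge0// ltW// !mulr_gt0.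
have gap_gt0 : 0 < gap t by rewrite lt_neqAle eq_sym gap_neq0 gap_ge0.
have energyE : energy t = energy_inf + gap t by rewrite /gap subrKC.
have [w wH wq] := Hfun_trajectory_subdiff t t0.
have := hKL _ (rhoU _ xt); rewrite Hfun_trajectory// Hfun_cluster energyE.
rewrite lte_fin ltrDl gap_gt0 nuP// => /(_ isT isT).
rewrite -EFinB addrAC subrr add0r /=.
rewrite derive1_powRZ// (_ : 1 - theta - 1 = - theta); last by ring.
have d0 : 0 <= C * ((1 - theta) * gap t `^ (- theta)).
  by rewrite mulr_ge0 ?mulr_ge0 ?powR_ge0 ?ltW.
move=> h; have {h} : (1 <= (C * ((1 - theta) * gap t `^ (- theta)) * enorm w)%:E)%E.
  apply: (le_trans h); rewrite [leRHS]EFinM; apply: lee_wpmul2l; first by rewrite lee_fin.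
  rewrite /edist -(enormN w) -(sub0r w); apply: ereal_inf_lbound.
  by exists w.
rewrite lee_fin powRN => h.
have p0 : 0 < gap t `^ theta by rewrite powR_gt0.
have : gap t `^ theta <= C * (1 - theta) * enorm w.
  move: h; rewrite -(ler_pM2r p0) mul1r.
  have -> : C * ((1 - theta) / gap t `^ theta) * enorm w * gap t `^ theta =
     C * (1 - theta) * enorm w by field; rewrite gt_eqF.
  by [].
move/le_trans; apply; rewrite -[leRHS]mulrA; apply: ler_wpM2l => //.
by rewrite mulr_ge0 ?ltW.
Qed.

Lemma lojasiewicz_local theta : 0 < theta < 1 ->
  lojasiewicz_exponent (Hfun eta f g) (row_mx xbar xbar) theta ->
  exists rho K, [/\ 0 < rho, 0 < K &
    forall t, 0 <= t ->
      enorm (row_mx (x t + q t) (x t) - row_mx xbar xbar) < rho ->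
      gap t `^ theta <= K * enorm (q t)].
Proof.
move=> th01 [C [rho [C0 rho0 hL]]].
have L0 : 0 < beta + eta^-1 by rewrite ltr_wpDl ?invr_gt0.
exists rho, (C * (beta + eta^-1)); split=> //; first by rewrite mulr_gt0.
move=> t t0 xt; have [w wH wq] := Hfun_trajectory_subdiff t t0.
have := hL _ w xt wH; rewrite Hfun_trajectory// Hfun_cluster.
rewrite -EFinB abse_EFin poweR_EFin lee_fin ger0_norm ?gap_ge0//.
move/le_trans; apply; rewrite -[leRHS]mulrA; apply: ler_wpM2l => //.
exact: ltW.
Qed.

Lemma convergence_rates theta : 0 < theta < 1 ->
  (forall e, 0 < e -> exists T, forall t, T <= t -> enorm (x t - xbar) < e) ->
  lojasiewicz_exponent (Hfun eta f g) (row_mx xbar xbar) theta ->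
  exists a b c d t0 : R,
    [/\ 0 < a, 0 < b, 0 < c & 0 < d] /\ 0 <= t0 /\
    forall t, t0 <= t ->
      [/\ theta < 1 / 2 -> exists T : R, 0 <= T /\ forall s, T <= s -> x s = xbar,
          theta = 1 / 2 -> enorm (x t - xbar) <= a * expR (- b * t) &
          1 / 2 < theta -> enorm (x t - xbar) <=
            (c * t + d) `^ (- ((1 - theta) / (2 * theta - 1)))].
Proof.
move=> th01 xcvg /(lojasiewicz_local _ th01)[rho [K [rho0 K0 hloj]]].
have [T1 hT1] := xcvg (rho / 4) ltac:(by rewrite divr_gt0).
have [T2 T20 hT2] := velocity_small (rho / 4) ltac:(by rewrite divr_gt0).
pose T0 := Num.max T1 T2.
have T00 : 0 <= T0 by rewrite le_max T20 orbT.
have eventually t : T0 <= t -> gap t `^ theta <= K * enorm (q t).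
  rewrite ge_max => /andP[T1t T2t]; apply: hloj; first exact: le_trans T2t.
  apply: (le_lt_trans (dist_trajectory_le t)).
  have := hT1 t T1t; have := hT2 t T2t; lra.
have [thl|thg|the] := ltgtP theta (1 / 2).
- have fin := finite_time x q gap decay decay_gt0 x_right_step x_continuous gap_ge0
    gap_nonincreasing gap_right_dini xbar theta K T0 xcvg th01 K0 T00 eventually thl.
  (* Only the clause of the current regime has a satisfiable premise, so constants of the other
     regimes are set to 1. *)
  by exists 1, 1, 1, 1, 0; split=> //; split=> // t _; split=> // h; lra.
- have [c [d [c0 d0 hcd]]] := polynomial_rate x q gap decay decay_gt0 x_right_step
    x_continuous gap_ge0 gap_nonincreasing gap_right_dini xbar theta K T0 xcvg th01 K0
    T00 eventually thg.
  exists 1, 1, c, d, (2 * T0 + 1); split=> //; split; first by lra.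
  by move=> t tT; split=> [h|h|_]; [lra|lra|exact: hcd].
- have [a [b [a0 b0 hab]]] := exponential_rate x q gap decay decay_gt0 x_right_step
    x_continuous gap_ge0 gap_nonincreasing gap_right_dini xbar theta K T0 xcvg th01 K0
    T00 eventually the.
  exists a, b, 1, 1, T0; split=> //; split=> // t tT.
  by split=> [h|_|h]; [lra|exact: hab|lra].
Qed.

End ClusterPoint.

End Dynamics.

Theorem theorem13 (R : realType) (n : nat)
    (f : 'rV[R]_n -> \bar R) (g : 'rV[R]_n -> R) (beta eta : R)
    (x0 : 'rV[R]_n) (x : R -> 'rV[R]_n)
    (f_proper : proper_fun f)
    (f_convex : convex_efun f)
    (f_lsc : lower_semicontinuous f)
    (g_diff : forall u, differentiable g u)
    (beta_ge0 : 0 <= beta)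
    (g_lip : forall u v, enorm (grad g u - grad g v) <= beta * enorm (u - v))
    (fg_bounded_below : exists m : R, forall u, (m%:E <= objective f g u)%E)
    (eta_gt0 : 0 < eta)
    (eta_beta : eta * beta * (3 + eta * beta) < 1)
    (x_sol : FB_solution eta f g x0 x)
    (x_bounded : exists M : R, forall t, 0 <= t -> enorm (x t) <= M)
    (H_KL : forall z, dom_subdiff (Hfun eta f g) z ->
       exists C theta : R, [/\ 0 < C, 0 < theta < 1 &
         KL_property (Hfun eta f g) z (fun s => C * s `^ (1 - theta))]) :
  exists xbar : 'rV[R]_n,
    [/\ crit (objective f g) xbar,
        x t @[t --> +oo] --> xbar,
        crit (Hfun eta f g) (row_mx xbar xbar) &
        forall theta : R, 0 < theta < 1 ->
          lojasiewicz_exponent (Hfun eta f g) (row_mx xbar xbar) theta ->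
          exists a b c d t0 : R,
            [/\ 0 < a, 0 < b, 0 < c & 0 < d] /\ 0 <= t0 /\
            forall t, t0 <= t ->
              [/\ theta < 1 / 2 ->
                    exists T : R, 0 <= T /\ forall s, T <= s -> x s = xbar,
                  theta = 1 / 2 ->
                    enorm (x t - xbar) <= a * expR (- b * t) &
                  1 / 2 < theta ->
                    enorm (x t - xbar) <=
                      (c * t + d) `^ (- ((1 - theta) / (2 * theta - 1)))]].
Proof.
have [dx [x_der _ _ x_eq]] := x_sol.
have [lb fg_ge] := fg_bounded_below.
have [M xM] := x_bounded.
have g_quad u v := gradient_quadratic_bound g beta u v g_diff beta_ge0 g_lip.
have [xbar clx] := trajectory_cluster f g (grad g) beta eta lb M x dx f_proper f_convex
  f_lsc beta_ge0 g_lip g_quad fg_ge eta_gt0 eta_beta x_der x_eq xM.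
have critH := crit_Hfun_cluster f g (grad g) beta eta lb x dx f_proper f_convex
  f_lsc beta_ge0 g_lip g_quad fg_ge eta_gt0 eta_beta x_eq xbar clx.
(* Criticality makes 0 a subgradient of [H] at the diagonal point, so the KL hypothesis applies
   there. *)
have [C [theta [C0 th01 KL]]] := H_KL _ (ex_intro _ 0 critH).
have [rho [mu [K [rho0 mu0 K0 hloc]]]] := KL_local f g (grad g) beta eta lb M x dx f_proper
  f_convex f_lsc beta_ge0 g_lip g_quad fg_ge eta_gt0 eta_beta x_der x_eq xM xbar clx
  C theta C0 th01 KL.
have x_cvg := local_lojasiewicz_cvg f g (grad g) beta eta lb M x dx f_proper f_convex
  f_lsc beta_ge0 g_lip g_quad fg_ge eta_gt0 eta_beta x_der x_eq xM xbar clx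
  theta K rho mu th01 K0 rho0 mu0 hloc.
exists xbar; split=> //.
- exact: crit_objective_cluster f g (grad g) beta eta lb x dx f_proper f_convex
    f_lsc beta_ge0 g_lip g_quad fg_ge eta_gt0 eta_beta x_eq xbar clx.
- apply/cvg_enormP => e e0; have [T hT] := x_cvg e e0.
  by exists T; split=> [|t /ltW]; [exact: num_real|exact: hT].
(* The exponent [th] of the rates need not equal the KL exponent [theta] that gave convergence. *)
- move=> th th01' loj.
  exact: convergence_rates f g (grad g) beta eta lb M x dx f_proper f_convex
    f_lsc beta_ge0 g_lip g_quad fg_ge eta_gt0 eta_beta x_der x_eq xM xbar clx
    th th01' x_cvg loj.
Qed.
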